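(* Let $u$ be the solution of the stochastic wave equation $\partial_t^2 u = \kappa^2\partial_x^2 u+\sigma(u)\dot W$ on $(0,\infty)\times\mathbb{R}$ with initial condition $u_0$ and initial derivative $v_0$. Let $\mathrm{L}_\sigma:=\inf_{x\ne 0}|\sigma(x)/x|$. If $\inf_{x\in\mathbb{R}}u_0(x)>0$, $v_0\ge 0$ and $\mathrm{L}_\sigma>0$, then $$\bar\gamma(2):=\limsup_{t\to\infty}\frac1t\sup_{x\in\mathbb{R}}\log \mathrm{E}[|u(t,x)|^2]\ \ge\ \mathrm{L}_\sigma\sqrt{\kappa/2}.$$
   Context: $\dot W$ is space-time white noise on $[0,\infty)\times\mathbb{R}$, $\kappa>0$, $\sigma:\mathbb{R}\to\mathbb{R}$ is globally Lipschitz, and $u_0:\mathbb{R}\to\mathbb{R}_+$, $v_0:\mathbb{R}\to\mathbb{R}$ are non-random, bounded and measurable. ''The solution'' means the a.s.-unique mild (random field) solution in the sense of Walsh and Dalang, i.e. for $t>0$, $x\in\mathbb{R}$, $$u(t,x)=\tfrac12\big(u_0(x+\kappa t)+u_0(x-\kappa t)\big)+\tfrac12\int_{x-\kappa t}^{x+\kappa t}v_0(y)\,dy+\int_0^t\int_{\mathbb{R}}\Gamma_{t-s}(y-x)\,\sigma(u(s,y))\,W(ds,dy),$$ where $\Gamma_t(x)=\frac12\mathbf{1}_{[-\kappa t,\kappa t]}(x)$ and the stochastic integral is in the sense of Walsh. *)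

(* Defs.v *)
From HB Require Import structures.
From mathcomp Require Import all_boot all_order all_algebra.
From mathcomp Require Import all_classical all_reals all_analysis.

Set Implicit Arguments.
Unset Strict Implicit.
Unset Printing Implicit Defensive.

Import Order.TTheory GRing.Theory Num.Theory.
Import numFieldNormedType.Exports.

Local Open Scope classical_set_scope.
Local Open Scope ring_scope.

(* A space-time point is a pair (time, space); a random field is curried in
   the order time, space, sample point. *)

Notation lebesgue2 := (lebesgue_measure \x lebesgue_measure)%E.

Section white_noise.
Context {R : realType}.

Definition positive_times : set (R * R) := `]0, +oo[ `*` setT.

(* Variance 0 is treated apart: the library's [normal_prob m 0] is the uniform
   law on [0, 1], not the point mass at m. *)
Definition centered_gaussian (v : R) : set R -> \bar R :=
  if v == 0 then dirac (0 : R) else normal_prob 0 (Num.sqrt v).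

Context {d : measure_display} {T : measurableType d}.
Variable P : probability T R.

(* The product rule for subfamilies is the case where some E i is setT. *)
Definition mutually_independent n (X : 'I_n -> T -> R) :=
  forall E : 'I_n -> set R, (forall i, measurable (E i)) ->
    P (\bigcap_i (X i @^-1` E i)) = (\prod_(i < n) P (X i @^-1` E i))%E.

Definition noise_domain (A : set (R * R)) :=
  [/\ measurable A, A `<=` `[0, +oo[ `*` setT & (lebesgue2 A < +oo)%E].

(* W A is the mass that the noise gives to A; it is irrelevant when A is
   outside of noise_domain. *)
Definition white_noise (W : set (R * R) -> {RV P >-> R}) :=
  [/\ forall A, noise_domain A -> forall E, measurable E ->
        distribution P (W A) E = centered_gaussian (fine (lebesgue2 A)) E,
      forall n (A : 'I_n -> set (R * R)),
        (forall i, noise_domain (A i)) -> trivIset setT A ->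
        mutually_independent (fun i => W (A i) : T -> R) &
      forall A B, noise_domain A -> noise_domain B -> A `&` B = set0 ->
        {ae P, forall w, W (A `|` B) w = W A w + W B w}].

Variable W : set (R * R) -> {RV P >-> R}.

Definition noise_filtration (t : R) : set (set T) :=
  <<s [set G | exists A E, [/\ noise_domain A, A `<=` `[0, t] `*` setT,
                               measurable E & G = W A @^-1` E]]
      `|` [set G | measurable G /\ P G = 0%E] >>.

End white_noise.

Section walsh_integral.
Context {R : realType} {d : measure_display} {T : measurableType d}.
Variables (P : probability T R) (W : set (R * R) -> {RV P >-> R}).

Definition predictable_rectangle : set (set (R * R * T)) :=
  [set Q | exists a b A G, [/\ 0 <= a, measurable A, noise_filtration W a G &
             Q = ((`]a, b] `*` A) `*` G)]].

Definition predictable (f : R -> R -> T -> R) :=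
  let D : set (R * R * T) := positive_times `*` setT in
  forall E : set R, measurable E ->
    <<s D, predictable_rectangle >>
      (D `&` [set p | E (f p.1.1 p.1.2 p.2)]).

Record elementary := Elementary {
  el_coef : T -> R ; el_lo : R ; el_hi : R ; el_set : set R }.

(* The process X(w) 1_(lo, hi](s) 1_A(y), X bounded and F_lo-measurable. *)
Definition elementary_ok (e : elementary) :=
  [/\ 0 <= el_lo e <= el_hi e,
      measurable (el_set e) /\ (lebesgue_measure (el_set e) < +oo)%E,
      exists M, forall w, `|el_coef e w| <= M &
      forall E, measurable E ->
        noise_filtration W (el_lo e) (el_coef e @^-1` E)].

Definition simple_val n (phi : 'I_n -> elementary) (s y : R) (w : T) : R :=
  \sum_(i < n)
    el_coef (phi i) w * \1_(`]el_lo (phi i), el_hi (phi i)]) s *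
      \1_(el_set (phi i)) y.

Definition simple_int n (phi : 'I_n -> elementary) (w : T) : R :=
  \sum_(i < n)
    el_coef (phi i) w *
      W (`]el_lo (phi i), el_hi (phi i)] `*` el_set (phi i)) w.

Definition field_norm2 (f : R -> R -> T -> R) : \bar R :=
  (\int[P]_w \int[lebesgue2]_(z in positive_times)
     ((f z.1 z.2 w) ^+ 2)%:E)%E.

(* I is a version of the Walsh integral of f over (0, oo) x R, obtained by the
   L^2 extension of simple_int. *)
Definition walsh_integral (f : R -> R -> T -> R) (I : T -> R) :=
  [/\ predictable f, (field_norm2 f < +oo)%E, measurable_fun setT I &
      exists (m : nat -> nat) (phi : forall n, 'I_(m n) -> elementary),
      [/\ forall n i, elementary_ok (phi n i),
          field_norm2 (fun s y w => simple_val (phi n) s y w - f s y w)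
            @[n --> \oo] --> 0%E &
          ('E_P[fun w => ((simple_int (phi n) w - I w) ^+ 2)%R])%E
            @[n --> \oo] --> 0%E]].

End walsh_integral.

Section wave_equation.
Context {R : realType} {d : measure_display} {T : measurableType d}.

Definition wave_kernel (kappa t x : R) : R :=
  2^-1 * \1_(`[- (kappa * t), kappa * t]) x.

Definition wave_free (kappa : R) (u0 v0 : R -> R) (t x : R) : R :=
  2^-1 * (u0 (x + kappa * t) + u0 (x - kappa * t)) +
  2^-1 * \int[lebesgue_measure]_(y in `[x - kappa * t, x + kappa * t]) v0 y.

(* The second condition is the class of random fields in which the mild
   solution exists and is unique up to modification. *)
Definition mild_solution (P : probability T R)
    (W : set (R * R) -> {RV P >-> R}) (kappa : R) (sg u0 v0 : R -> R)
    (u : R -> R -> T -> R) :=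
  [/\ predictable W u,
      forall t1 : R, exists M : R, forall t x : R, 0 < t <= t1 ->
        ('E_P[fun w => (`|u t x w| ^+ 2)%R] <= M%:E)%E &
      forall t x : R, 0 < t -> exists I : T -> R,
        walsh_integral W (fun s y w =>
          \1_(`]0, t]) s * wave_kernel kappa (t - s) (y - x) * sg (u s y w)) I
        /\ {ae P, forall w, u t x w = wave_free kappa u0 v0 t x + I w}].

Definition L_lower (sg : R -> R) : R :=
  inf [set `|sg x / x| | x in [set x : R | x != 0]].

Definition upper_lyapunov2 (P : probability T R) (u : R -> R -> T -> R)
  : \bar R :=
  limf_esup (fun t : R => (t^-1)%:E *
      ereal_sup (range (fun x : R => lne 'E_P[fun w => (`|u t x w| ^+ 2)%R])))%E
    (pinfty_nbhs R).

End wave_equation.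

(* Main.v *)
Require Import Defs.
From HB Require Import structures.
From mathcomp Require Import all_boot all_order all_algebra.
From mathcomp Require Import all_classical all_reals all_analysis.
From mathcomp Require Import measurable_realfun ring lra.

(** Why the bound holds.

    Split the solution into its deterministic part J and its Walsh integral I.
    With m = inf u0, the assumptions on the initial data give J >= m > 0.  The
    Walsh integral is centred, so E u(t,x)^2 is J^2 + E I^2, and the isometry
    of the stochastic integral turns E I^2 into the integral of
    E sigma(u(s,y))^2 / 4 over the backward light cone of (t, x).  There
    sigma(u)^2 >= L^2 u^2, and the section of the cone at time s is an interval
    of length 2 kappa (t - s).  Hence, if p(s) bounds E u(s,y)^2 from below
    uniformly in y, then so does
      m^2 + (L^2 kappa / 2) * (integral of (t - s) p(s) for s in ]0, t])
    at time t (second_moment_ge).  Starting from p = 0, the iterates are the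
    partial sums of the power series of m^2 cosh(a t) with
    a = L sqrt(kappa / 2), so that E u(t,x)^2 >= m^2 e^(a t) / 2
    (second_moment_exponential), and a bounds the Lyapunov exponent from below.

    The probabilistic content is the isometry, and it is developed from the
    definition of white noise.  The noise of a set that lies after time a is
    independent of the filtration at time a (noise_filtration_indep), has mean
    0, and has the area of the set as variance (white_noise_moments, which
    rests on the moments of the normal law).  Cutting the boxes of two
    elementary processes at the later of their starting times then gives the
    isometry for simple processes (simple_isometry).  For general integrands
    the inequality c^2 + ||f||^2 <= E (c + I)^2 suffices
    (walsh_second_moment).  It passes to the L^2 limit by means of
      x^2 <= (1 + e) y^2 + (1 + 1/e) (x - y)^2,
    used once on the sample space and once on space-time. *)

Set SsrOldRewriteGoalsOrder.
Set Implicit Arguments.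
Unset Strict Implicit.
Unset Printing Implicit Defensive.

Import Order.TTheory GRing.Theory Num.Theory.
Import numFieldNormedType.Exports.

Local Open Scope classical_set_scope.
Local Open Scope ring_scope.

(** * Moments of the normal law *)

Section density.
Local Open Scope ereal_scope.
Context {d} {T : measurableType d} {R : realType}.
Variables (mu m : {measure set T -> \bar R}) (p : T -> R).
Hypotheses (mp : measurable_fun setT p) (p0 : forall x, (0 <= p x)%R).
Hypothesis mE : forall A, measurable A -> m A = \int[mu]_(x in A) (p x)%:E.

Import HBNNSimple.

(** Holds by assumption for indicators, and extends to simple functions and
    then to monotone limits. *)
Lemma ge0_integral_density (f : T -> \bar R) :
  measurable_fun setT f -> (forall x, 0 <= f x) ->
  \int[m]_x f x = \int[mu]_x (f x * (p x)%:E).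
Proof.
move=> mf f0; pose f_ := nnsfun_approx measurableT mf.
have mfp n : measurable_fun setT (fun x => (f_ n x * p x)%:E).
  by apply/measurable_EFinP/measurable_funM.
have fE x : f x = limn (EFin \o f_ ^~ x).
  by apply/esym/cvg_lim => //; exact: cvg_nnsfun_approx.
transitivity (limn (fun n => \int[m]_x (f_ n x)%:E)).
  rewrite -monotone_convergence//=.
  - exact: eq_integral.
  - by move=> n; exact/measurable_EFinP.
  - by move=> n x _; rewrite lee_fin.
  - by move=> x _ i j ij; rewrite lee_fin; exact/lefP/nd_nnsfun_approx.
transitivity (limn (fun n => \int[mu]_x (f_ n x * p x)%:E)); last first.
  rewrite -monotone_convergence//=.
  - apply: eq_integral => x _; apply/cvg_lim => //.
    under eq_fun do rewrite EFinM.
    by apply: cvgeZr => //; exact: cvg_nnsfun_approx.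
  - by move=> n x _; rewrite lee_fin mulr_ge0.
  - move=> x _ i j ij; rewrite lee_fin ler_wpM2r//.
    exact/lefP/nd_nnsfun_approx.
congr (lim (_ @ \oo)); apply/funext => n.
under eq_integral do rewrite fimfunE -fsumEFin//.
have rA0 r x : (0 <= r * \1_(f_ n @^-1` [set r]) x)%R.
  have := nnfun_muleindic_ge0 (f_ n) r x.
  by rewrite -EFinM lee_fin.
rewrite ge0_integral_fsum//; last 2 first.
  - by move=> r; exact/measurable_EFinP/measurable_funM.
  - by move=> r x _; rewrite lee_fin.
under [RHS]eq_integral => x _ do rewrite fimfunE mulr_fsuml -fsumEFin//.
rewrite ge0_integral_fsum//; last 2 first.
  - by move=> r; apply/measurable_EFinP; do 2 apply: measurable_funM => //.
  - by move=> r x _; rewrite lee_fin mulr_ge0.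
apply: eq_fsbigr => r _.
have [r0|r0] := ltP r 0%R.
  by rewrite preimage_nnfun0// !integral0_eq// => x _; rewrite indic0 mulr0 ?mul0r.
have mA : measurable (f_ n @^-1` [set r]) by [].
under eq_integral do rewrite EFinM.
under [RHS]eq_integral do rewrite -mulrA EFinM.
rewrite !ge0_integralZl_EFin//; last 3 first.
- by move=> x _; rewrite lee_fin mulr_ge0.
- by apply/measurable_EFinP/measurable_funM.
- exact/measurable_EFinP.
rewrite integral_indic// setIT mE// integral_mkcond.
congr (_ * _); apply: eq_integral => x _.
by rewrite patchE indicE; case: ifPn => _; rewrite ?mul1r ?mul0r.
Qed.
End density.

Section gaussian_moments.
Context {R : realType}.
Local Notation mu := (@lebesgue_measure R).
Variable c : R.
Hypothesis c0 : 0 < c.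
Let E (y : R) := expR (- (c * y ^+ 2)).

Let E_ge0 y : 0 <= E y. Proof. exact: expR_ge0. Qed.

Let E_even y : E (- y) = E y. Proof. by rewrite /E sqrrN. Qed.

Let dE (y : R) : is_derive y 1 E (- (2 * c) * y * E y).
Proof.
rewrite /E; apply: is_derive_eq => /=.
by rewrite /GRing.scale /=; ring.
Qed.

Let E_cont : continuous E.
Proof.
move=> y; apply: differentiable_continuous; apply/derivable1_diffP.
by have [] := dE y.
Qed.

Let E_lim : E y @[y --> +oo%R] --> 0.
Proof.
apply: (cvg_comp (fun y => c * y ^+ 2) (fun x => expR (- x))).
  by apply: gt0_cvgMry => //; exact: cvgr_expr2.
exact: cvgr_expR.
Qed.

Let mE : measurable_fun setT E. Proof. exact: continuous_measurable_fun. Qed.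

Let yE_cont : continuous (fun y : R => y * E y).
Proof. by move=> y; apply: cvgM; [exact: cvg_id|exact: E_cont]. Qed.

Local Open Scope ereal_scope.

Let tail_integral (x : R) : (0 <= x)%R ->
  \int[mu]_(y in `[x, +oo[) (y * E y)%:E = ((2 * c)^-1 * E x)%:E.
Proof.
move=> x0.
have c20 : (2 * c != 0)%R by rewrite mulf_neq0// gt_eqF.
pose F (y : R) := (- (2 * c)^-1 * E y)%R.
have dF (y : R) : is_derive y 1%R F (y * E y)%R.
  rewrite /F; apply: is_derive_eq => /=.
  by rewrite /GRing.scale /= -/(E y); field; rewrite gt_eqF.
have -> : ((2 * c)^-1 * E x = 0 - F x)%R by rewrite /F mulNr sub0r opprK.
apply: ge0_continuous_FTC2y.
- by move=> y xy; rewrite mulr_ge0// (le_trans x0).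
- exact/continuous_subspaceT/yE_cont.
- by rewrite -[X in _ --> X](mulr0 (- (2 * c)^-1)%R); exact: cvgMr.
- by move=> y _; have [] := dF y.
- by rewrite /F; apply: cvgMr; exact/cvg_at_right_filter/E_cont.
- by move=> y _; rewrite derive1E; have [] := dF y.
Qed.

(** The value e^(- c x^2) is the integral of 2 c y e^(- c y^2) over y >= x.
    Integrating over x >= 0 and exchanging the two integrals multiplies the
    integrand by the length y of the interval of admissible x, which turns the
    total mass of the Gaussian into its second moment. *)
Lemma second_moment_gauss :
  \int[mu]_y (y ^+ 2 * expR (- (c * y ^+ 2)))%:E
  = ((2 * c)^-1)%:E * \int[mu]_y (expR (- (c * y ^+ 2)))%:E.
Proof.
have dom : [set x : R | (0 <= x)%R] = `[0%R, +oo[%classic by rewrite set_itvcy.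
have mul_cont (f g : R -> R) : continuous f -> continuous g ->
    continuous (fun x => f x * g x)%R.
  by move=> cf cg x; apply: cvgM; [exact: cf|exact: cg].
rewrite (@ge0_symfun_integralT _ (fun y => y ^+ 2 * E y)%R); last 3 first.
- by move=> y; rewrite mulr_ge0 ?sqr_ge0.
- by apply: mul_cont => //; exact: exprn_continuous.
- by move=> y /=; rewrite sqrrN E_even.
rewrite (@ge0_symfun_integralT _ E)//; last first.
  by move=> y /=; rewrite E_even.
rewrite muleCA; congr (_ * _); rewrite dom.
pose A := [set z : R * R | (0 <= z.1 <= z.2)%R].
have mA : measurable A.
  rewrite (_ : A = (fst @^-1` `[0%R, +oo[) `&`
      ((fun z => z.2 - z.1)%R @^-1` `[0%R, +oo[)); last first.
    apply/seteqP; split => z /=; rewrite !in_itv/= !andbT subr_ge0.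
      by move=> /andP[].
    by move=> [a b]; apply/andP.
  have m12 : measurable_fun setT (fun z : R * R => z.2 - z.1)%R.
    exact: measurable_funB.
  by apply: measurableI; rewrite -[X in measurable X]setTI;
    [apply: measurable_fst|apply: m12].
pose K (z : R * R) := (\1_A z * (z.2 * E z.2))%:E.
have mK : measurable_fun setT K.
  apply/measurable_EFinP/measurable_funM => //.
  apply: measurable_funM => //.
  by apply: measurableT_comp => //; exact: measurable_snd.
have K0 z : 0 <= K z.
  rewrite /K lee_fin indicE; case: (boolP (z \in A)) => [|_]; last first.
    by rewrite mul0r.
  rewrite inE /A /= => /andP[z1 z12].
  by rewrite mul1r mulr_ge0// (le_trans z1).
transitivity (\int[mu]_y \int[mu]_x K (x, y)).
  rewrite integral_mkcond; apply: eq_integral => y _.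
  rewrite patchE mem_setE in_itv/= andbT.
  have [y0|y0] := leP 0%R y; last first.
    apply/esym; apply: integral0_eq => x _.
    rewrite /K indicE memNset; first by rewrite mul0r.
    by move=> /andP[x0 /(le_trans x0)]; rewrite leNgt y0.
  transitivity (\int[mu]_x ((y * E y)%:E * (\1_`[0%R, y] x)%:E)).
    have yE0 : (0 <= y * E y)%R by rewrite mulr_ge0.
    have mi : measurable_fun setT (fun x : R => (\1_`[0%R, y] x : R)%:E).
      by apply/measurable_EFinP; exact: measurable_indic.
    have i0 (x : R) : setT x -> 0 <= (\1_`[0%R, y] x : R)%:E by rewrite lee_fin.
    rewrite (ge0_integralZl_EFin mu measurableT i0 mi yE0).
    have -> : \int[mu]_x (\1_`[0%R, y] x : R)%:E = y%:E.
      rewrite integral_indic; [|exact: measurableT|exact: measurable_itv].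
      rewrite setIT /= lebesgue_measure_itv/= lte_fin.
      case: ltP => y1; first by rewrite sube0.
      by rewrite (@le_anti _ _ y 0%R) ?y0 ?y1.
    by rewrite -EFinM; congr EFin; ring.
  apply: eq_integral => x _; rewrite /K !indicE -EFinM mulrC.
  have -> : ((x, y) \in A) = (x \in `[0%R, y]%classic).
    by rewrite !mem_setE in_itv.
  by [].
rewrite -(@fubini_tonelli _ _ _ _ _ mu mu K mK K0).
have c20 : (0 <= (2 * c)^-1)%R by rewrite invr_ge0 mulr_ge0// ltW.
have mEp : measurable_fun (`[0%R, +oo[%classic : set R) (fun x : R => (E x)%:E).
  by apply: measurable_funTS; exact/measurable_EFinP.
have Ep0 (x : R) : (`[0%R, +oo[%classic : set R) x -> 0 <= (E x)%:E by rewrite lee_fin.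
rewrite -(ge0_integralZl_EFin mu (measurable_itv _) Ep0 mEp c20).
rewrite [RHS]integral_mkcond; apply: eq_integral => x _.
rewrite patchE mem_setE in_itv/= andbT.
have [x0|x0] := leP 0%R x; last first.
  apply: integral0_eq => y _.
  rewrite /K indicE memNset; first by rewrite mul0r.
  by move=> /andP[]; rewrite leNgt x0.
rewrite -EFinM -tail_integral// [RHS]integral_mkcond.
apply: eq_integral => y _.
rewrite patchE mem_setE in_itv/= andbT /K indicE.
have -> : ((x, y) \in A) = (x <= y)%R.
  by rewrite mem_setE; exact: andb_idl.
by case: (x <= y)%R; rewrite ?mul1r ?mul0r.
Qed.

End gaussian_moments.

Section normal_moments.
Local Open Scope ereal_scope.
Context {R : realType}.
Local Notation mu := (@lebesgue_measure R).

Lemma normal_second_moment (s : R) : (s != 0)%R ->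
  \int[normal_prob 0 s]_x (x ^+ 2)%:E = (s ^+ 2)%:E.
Proof.
move=> s0.
have m2 : measurable_fun setT (fun x : R => x ^+ 2)%R by exact: measurable_funX.
have m2E : measurable_fun setT (fun x : R => (x ^+ 2)%:E).
  exact/measurable_EFinP.
have sq0 (x : R) : 0 <= (x ^+ 2)%:E by rewrite lee_fin sqr_ge0.
rewrite (@ge0_integral_density _ _ _ mu (normal_prob 0 s) _
  (measurable_normal_pdf 0 s) (normal_pdf_ge0 0 s) (fun A mA => erefl) _ m2E sq0).
have s20 : (0 < s ^+ 2)%R by rewrite exprn_even_gt0.
pose c : R := (s ^+ 2 *+ 2)^-1%R.
have c0 : (0 < c)%R by rewrite invr_gt0 mulrn_wgt0.
have pdfE x : normal_pdf 0 s x = (normal_peak s * expR (- (c * x ^+ 2)))%R.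
  rewrite normal_pdfE//; congr (_ * expR _)%R.
  by rewrite subr0 /c mulNr [in RHS]mulrC.
have mE : measurable_fun setT (fun x : R => expR (- (c * x ^+ 2))).
  apply: measurableT_comp; first exact: measurable_expR.
  apply: measurableT_comp; first exact: oppr_measurable.
  by apply: measurable_funM; [exact: measurable_cst|exact: m2].
have p0 := normal_peak_ge0 s.
have E0 (x : R) : setT x -> 0 <= (expR (- (c * x ^+ 2)))%:E.
  by rewrite lee_fin expR_ge0.
have xE0 (x : R) : setT x -> 0 <= (x ^+ 2 * expR (- (c * x ^+ 2)))%:E.
  by rewrite lee_fin mulr_ge0 ?sqr_ge0 ?expR_ge0.
have mEE : measurable_fun setT (fun x : R => (expR (- (c * x ^+ 2)))%:E).
  exact/measurable_EFinP.
have mxE : measurable_fun setT (fun x : R => (x ^+ 2 * expR (- (c * x ^+ 2)))%:E).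
  by apply/measurable_EFinP; apply: measurable_funM.
under eq_integral do rewrite pdfE -EFinM mulrCA EFinM.
rewrite (ge0_integralZl_EFin mu measurableT xE0 mxE p0) second_moment_gauss//.
rewrite muleCA -(ge0_integralZl_EFin mu measurableT E0 mEE p0).
under eq_integral do rewrite -EFinM -pdfE.
rewrite integral_normal_pdf mule1; congr EFin.
by rewrite /c; field.
Qed.

Lemma ge0_integral_lebesgueN (f : R -> \bar R) :
  measurable_fun setT f -> (forall x, 0 <= f x) ->
  \int[mu]_x f (- x)%R = \int[mu]_x f x.
Proof.
move=> mf f0.
transitivity (\int[pushforward mu (-%R : _ -> measurableTypeR R)]_x f x).
  by rewrite ge0_integral_pushforward.
by apply: eq_measure_integral => A mA _; exact: lebesgue_measureN.
Qed.

(** The positive and the negative part of x have the same integral, by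
    symmetry of the density, and it is finite since x <= 1 + x^2. *)
Lemma normal_first_moment (s : R) : (s != 0)%R ->
  \int[normal_prob 0 s]_x x%:E = 0.
Proof.
move=> s0.
have mpdf := measurable_normal_pdf 0 s.
have pdfN x : normal_pdf 0 s (- x)%R = normal_pdf 0 s x.
  by rewrite !normal_pdfE// /normal_fun !subr0 sqrrN.
have part (f : R -> R) : measurable_fun setT f ->
    (forall x, (0 <= f x)%R) ->
    \int[normal_prob 0 s]_x (f x)%:E
    = \int[mu]_x ((f x)%:E * (normal_pdf 0 s x)%:E).
  move=> mf f0; rewrite (@ge0_integral_density _ _ _ mu _ (normal_pdf 0 s))//.
  - by move=> x; exact: normal_pdf_ge0.
  - exact/measurable_EFinP.
have mid : measurable_fun setT (fun x : R => x) by exact: measurable_id.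
have mp : measurable_fun setT (fun x : R => Num.max x 0)%R.
  exact: measurable_maxr.
have mn : measurable_fun setT (fun x : R => Num.max (- x) 0)%R.
  by apply: measurable_maxr => //; exact: measurableT_comp.
have max0 (x : R) : (0 <= Num.max x 0)%R by rewrite le_max lexx orbT.
rewrite integralE.
rewrite (_ : (fun x : R => x%:E)^\+ = (fun x : R => (Num.max x 0)%:E)); last first.
  by apply/funext => x; rewrite funeposE EFin_max.
rewrite (_ : (fun x : R => x%:E)^\- = (fun x : R => (Num.max (- x) 0)%:E)); last first.
  by apply/funext => x; rewrite funenegE EFin_max EFinN.
rewrite [X in _ - X]part// -[X in _ - X]ge0_integral_lebesgueN; last 2 first.
- by apply: emeasurable_funM; apply/measurable_EFinP.
- by move=> x; rewrite -EFinM lee_fin mulr_ge0 ?normal_pdf_ge0.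
under [X in _ - X]eq_integral do rewrite opprK pdfN.
rewrite -part// subee// ge0_fin_numE; last first.
  by apply: integral_ge0 => x _; rewrite lee_fin.
apply: (@le_lt_trans _ _ (\int[normal_prob 0 s]_x (1%:E + (x ^+ 2)%:E))).
  apply: ge0_le_integral => //.
  - by move=> x _; rewrite lee_fin.
  - exact/measurable_EFinP.
  - by apply: emeasurable_funD => //; apply/measurable_EFinP; exact: measurable_funX.
  - move=> x _; rewrite -EFinD lee_fin ge_max addr_ge0 ?sqr_ge0// andbT.
    by have := sqr_ge0 (x - 1); nra.
rewrite ge0_integralD//; last 2 first.
- by move=> x _; rewrite lee_fin sqr_ge0.
- by apply/measurable_EFinP; exact: measurable_funX.
rewrite normal_second_moment// integral_cst//.
by rewrite /= /normal_prob integral_normal_pdf mule1 -EFinD ltry.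
Qed.

Lemma centered_gaussian_moments d (T : measurableType d) (P : probability T R)
    (X : {RV P >-> R}) (v : R) : (0 <= v)%R ->
  (forall E, measurable E -> distribution P X E = centered_gaussian v E) ->
  [/\ P.-integrable setT (EFin \o X), \int[P]_w (X w)%:E = 0 &
      \int[P]_w (X w ^+ 2)%:E = v%:E].
Proof.
move=> v0 XE.
have mX : measurable_fun setT X by [].
(* Lebesgue measure, hence the normal law, lives on the copy measurableTypeR
   of R, whose measurable sets are those of R. *)
have mX' : measurable_fun setT (X : T -> measurableTypeR R) by [].
pose X' : {RV P >-> measurableTypeR R} :=
  HB.pack (X : T -> measurableTypeR R) (isMeasurableFun.Build _ _ _ _ _ mX').
have m2 : measurable_fun setT (fun x : measurableTypeR R => (x ^+ 2)%:E).
  by apply/measurable_EFinP; exact: measurable_funX.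
have m1 : measurable_fun setT (fun x : measurableTypeR R => x%:E).
  exact/measurable_EFinP.
have X2 : \int[P]_w (X w ^+ 2)%:E = v%:E.
  transitivity (\int[distribution P X']_x (x ^+ 2)%:E).
    by rewrite ge0_integral_distribution// => x; rewrite lee_fin sqr_ge0.
  have [v00|vn0] := eqVneq v 0%R.
    rewrite (eq_measure_integral (\d_(0%R : measurableTypeR R))); last first.
      move=> A mA _; transitivity (centered_gaussian v A); first exact: XE.
      by rewrite /centered_gaussian v00 eqxx.
    by rewrite integral_dirac// diracT mul1e v00 expr0n.
  transitivity (\int[normal_prob 0 (Num.sqrt v)]_x (x ^+ 2)%:E).
    apply: eq_measure_integral => A mA _.
    transitivity (centered_gaussian v A); first exact: XE.
    by rewrite /centered_gaussian (negbTE vn0).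
  by rewrite normal_second_moment ?sqr_sqrtr// sqrtr_eq0 -ltNge lt0r vn0.
have iX : P.-integrable setT (EFin \o X).
  apply: (@le_integrable _ _ _ _ _ measurableT _
    (EFin \o (fun w => 1 + X w ^+ 2)%R)).
  - exact/measurable_EFinP.
  - move=> w _ /=; rewrite lee_fin [leRHS]ger0_norm ?addr_ge0 ?sqr_ge0//.
    have := sqr_ge0 (`|X w| - 1); rewrite sqrrB1 real_normK ?num_real//.
    by have := normr_ge0 (X w); nra.
  - apply/integrableP; split.
      by apply/measurable_EFinP/measurable_funD => //; exact: measurable_funX.
    under eq_integral.
      move=> w _; rewrite /= ger0_norm ?addr_ge0 ?sqr_ge0// EFinD; over.
    rewrite ge0_integralD//; last 2 first.
    + by move=> w _; rewrite lee_fin sqr_ge0.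
    + by apply/measurable_EFinP; exact: measurable_funX.
    rewrite X2 integral_cst// [X in _ * X + _](_ : _ = 1); last first.
      exact: probability_setT.
    by rewrite mule1 -EFinD ltry.
split => //.
transitivity (\int[distribution P X']_x x%:E).
  by rewrite integral_distribution.
have [v00|vn0] := eqVneq v 0%R.
  rewrite (eq_measure_integral (\d_(0%R : measurableTypeR R))); last first.
    move=> A mA _; transitivity (centered_gaussian v A); first exact: XE.
    by rewrite /centered_gaussian v00 eqxx.
  by rewrite integral_dirac// diracT mul1e.
transitivity (\int[normal_prob 0 (Num.sqrt v)]_x x%:E).
  apply: eq_measure_integral => A mA _.
  transitivity (centered_gaussian v A); first exact: XE.
  by rewrite /centered_gaussian (negbTE vn0).
by rewrite normal_first_moment// sqrtr_eq0 -ltNge lt0r vn0.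
Qed.

End normal_moments.

(** * Independence *)

Section independence.
Local Open Scope ereal_scope.
Context {R : realType} {d : measure_display} {T : measurableType d}.
Variable P : probability T R.

(** Dynkin's argument: the events that are independent of H form a
    lambda-system. *)
Lemma indep_generated (G : set (set T)) (H : set T) :
  setI_closed G -> G `<=` measurable -> measurable H ->
  (forall A, G A -> P (A `&` H) = P A * P H) ->
  forall A, <<s G >> A -> measurable A /\ P (A `&` H) = P A * P H.
Proof.
move=> GI Gm mH GH A sGA.
suff: <<s G >> `<=` [set A | measurable A /\ P (A `&` H) = P A * P H] by exact.
apply: lambda_system_subset => //; last first.
  by move=> B GB; split; [exact: Gm|exact: GH].
apply/dynkin_lambda_system; split.
- by split => //; rewrite setTI probability_setT mul1e.
- move=> B [mB BH]; split; first exact: measurableC.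
  have PBf : P B \is a fin_num by exact: fin_num_measure.
  rewrite setIC -setDE probability_setC// muleBl ?fin_num_measure//.
  rewrite mul1e measureD//; last by rewrite (le_lt_trans (probability_le1 P mH)) ?ltry.
  by rewrite setIC -BH setIC.
- move=> F tF FG; split.
    by apply: bigcup_measurable => k _; have [] := FG k.
  have mF k : measurable (F k) by have [] := FG k.
  rewrite setI_bigcupl measure_bigcup//=; last 2 first.
    by move=> k _; exact: measurableI.
    exact: trivIset_setIr.
  under eq_eseriesr => k _ do rewrite (FG k).2 muleC.
  rewrite measure_bigcup// muleC -(fineK (fin_num_measure P H mH)) nneseriesZl//.
Qed.

Section product_of_independent.
Variables (X Y : T -> R).
Hypotheses (mX : measurable_fun setT X) (mY : measurable_fun setT Y).
Hypothesis XY : forall A B, measurable A -> measurable B ->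
  P (X @^-1` A `&` Y @^-1` B) = P (X @^-1` A) * P (Y @^-1` B).

(** Independence makes the joint law the product of the two laws, because a
    product measure is determined by rectangles; then Fubini applies. *)
Lemma indep_expectationM :
  P.-integrable setT (EFin \o X) -> P.-integrable setT (EFin \o Y) ->
  P.-integrable setT (fun w => (X w * Y w)%:E) /\
  \int[P]_w (X w * Y w)%:E = \int[P]_w (X w)%:E * \int[P]_w (Y w)%:E.
Proof.
move=> iX iY.
pose Xr : {RV P >-> R} := HB.pack X (isMeasurableFun.Build _ _ _ _ X mX).
pose Yr : {RV P >-> R} := HB.pack Y (isMeasurableFun.Build _ _ _ _ Y mY).
pose Z w := (X w, Y w).
have mZ : measurable_fun setT Z by exact: measurable_fun_pair.
pose Zr : {RV P >-> (R * R)%type} :=  HB.pack Z (isMeasurableFun.Build _ _ _ _ Z mZ).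
pose nu := (distribution P Xr \x distribution P Yr)%E.
have nuE A : measurable A -> nu A = distribution P Zr A.
  by move=> mA; apply: product_measure_unique => // B C mB mC; rewrite -XY.
have mM : measurable_fun setT (fun z : R * R => (z.1 * z.2)%:E).
  by apply/measurable_EFinP; exact: measurable_funM.
have mid : measurable_fun setT (fun x : R => x%:E) by exact/measurable_EFinP.
have iXd : (distribution P Xr).-integrable setT (fun x : R => x%:E).
  exact: integrable_pushforward.
have iYd : (distribution P Yr).-integrable setT (fun x : R => x%:E).
  exact: integrable_pushforward.
have inu : nu.-integrable setT (fun z : R * R => (z.1 * z.2)%:E).
  apply/integrable12ltyP => //=.
  under eq_integral => x _.
    under eq_integral => y _ do rewrite /= normrM EFinM.
    rewrite ge0_integralZl//; last exact: measurableT_comp.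
    over.
  have /integrableP[_ iY'] := iYd; have /integrableP[_ iX'] := iXd.
  rewrite ge0_integralZr//.
  - rewrite lte_mul_pinfty ?ge0_fin_numE ?integral_ge0//.
  - exact: measurableT_comp.
  - exact: integral_ge0.
have iZ : P.-integrable setT (fun w => (X w * Y w)%:E).
  apply/integrableP; split; first by apply/measurable_EFinP/measurable_funM.
  have /integrableP[_] := inu; apply: le_lt_trans.
  rewrite (eq_measure_integral (distribution P Zr)); last by move=> A mA _; exact: nuE.
  by rewrite ge0_integral_distribution//; exact: measurableT_comp.
split => //.
transitivity (\int[nu]_z (z.1 * z.2)%:E).
  rewrite (eq_measure_integral (distribution P Zr)); last by move=> A mA _; exact: nuE.
  by rewrite integral_distribution.
rewrite -integral12_prod_meas1//= /fubini_F/=.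
under eq_integral => x _.
  under eq_integral => y _ do rewrite EFinM.
  rewrite integralZl//; over.
rewrite -(fineK (integrable_fin_num measurableT iYd)) integralZr//.
rewrite fineK ?(integrable_fin_num measurableT iYd)//.
by congr (_ * _); rewrite integral_distribution.
Qed.
End product_of_independent.
End independence.

(** * White noise: future and past are independent *)

Section white_noise_theory.
Local Open Scope ereal_scope.
Context {R : realType} {d : measure_display} {T : measurableType d}.
Variables (P : probability T R) (W : set (R * R) -> {RV P >-> R}).
Hypothesis hW : white_noise W.

Lemma noise_domainS (A B : set (R * R)) :
  noise_domain B -> measurable A -> A `<=` B -> noise_domain A.
Proof.
move=> [mB B0 Bfin] mA AB; split => //; first exact: subset_trans B0.
by apply: le_lt_trans Bfin; apply: le_measure => //; rewrite inE.
Qed.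

Lemma noise_domainU (A B : set (R * R)) :
  noise_domain A -> noise_domain B -> noise_domain (A `|` B).
Proof.
move=> [mA A0 Afin] [mB B0 Bfin]; split; first exact: measurableU.
  by rewrite subUset.
apply: (@le_lt_trans _ _ (lebesgue2 A + lebesgue2 B)).
  exact: measureU2.
exact: lte_add_pinfty.
Qed.

Lemma noise_domain0 : noise_domain (set0 : set (R * R)).
Proof. by split => //; rewrite measure0. Qed.

(** Additivity for the decomposition of the empty set into two empty sets. *)
Lemma white_noise0 : {ae P, forall w, W set0 w = 0%R}.
Proof.
have [_ _ /(_ _ _ noise_domain0 noise_domain0)] := hW.
rewrite setI0 setU0 => /(_ erefl); apply: filterS => w /eqP.
by rewrite -subr_eq0 opprD addrA subrr sub0r oppr_eq0 => /eqP.
Qed.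

Lemma white_noise_bigU (I : choiceType) (s : seq I) (A : I -> set (R * R)) :
  uniq s -> (forall i, noise_domain (A i)) -> trivIset setT A ->
  noise_domain (\big[setU/set0]_(i <- s) A i) /\
  {ae P, forall w, W (\big[setU/set0]_(i <- s) A i) w
    = (\sum_(i <- s) W (A i) w)%R}.
Proof.
move=> + dA tA; elim: s => [_|i s IH /= /andP[si us]].
  rewrite big_nil; split; first exact: noise_domain0.
  by apply: filterS white_noise0 => w; rewrite big_nil.
have [ds aes] := IH us; rewrite big_cons; split; first exact: noise_domainU.
have [_ _ /(_ _ _ (dA i) ds) /= aeU] := hW.
apply: filterS2 (aeU _) aes.
  by move=> w -> ->; rewrite big_cons.
rewrite -bigcup_seq setI_bigcupr; apply: bigcup0 => j /= js.
apply/eqP/negPn/negP => /set0P nj.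
by move: si; rewrite (tA i j) ?js.
Qed.

(** Transfers the product rule from ordinals to arbitrary finite index types,
    such as the sets of indices that label the atoms below. *)
Lemma white_noise_independent (I : finType) (A : I -> set (R * R))
    (E : I -> set R) :
  (forall i, noise_domain (A i)) -> trivIset setT A ->
  (forall i, measurable (E i)) ->
  P [set w | forall i, E i (W (A i) w)] = \prod_i P (W (A i) @^-1` E i).
Proof.
move=> dA tA mE; have [_ ind _] := hW.
have := ind _ (fun k => A (@enum_val I I k)) (fun k => dA _).
have tA' : trivIset setT (fun k => A (@enum_val I I k)).
  by move=> i j _ _ /(tA _ _ Logic.I Logic.I)/enum_val_inj.
move=> /(_ tA' (fun k => E (@enum_val I I k)) (fun k => mE _)) /= H.
rewrite (reindex _ (onW_bij _ (@enum_val_bij I))) /= -H; congr (P _).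
apply/seteqP; split => w /=; first by move=> wE k _; exact: wE.
by move=> wE i; have := wE (enum_rank i) Logic.I; rewrite /preimage/= enum_rankK.
Qed.

Lemma ae_eq_set (A B : set T) : measurable A -> measurable B ->
  {ae P, forall w, A w <-> B w} -> P A = P B.
Proof.
move=> mA mB AB.
rewrite -[A]setIT -[B]setIT -!integral_indic//.
apply: ge0_ae_eq_integral => //.
- exact/measurable_EFinP.
- exact/measurable_EFinP.
apply: filterS AB => w AB _; rewrite !indicE.
by have -> : (w \in A) = (w \in B) by apply/idP/idP; rewrite !inE => /AB.
Qed.

Definition noise_event (I : Type) (A : I -> set (R * R)) (E : I -> set R) :=
  [set w | forall i, E i (W (A i) w)].

Lemma measurable_noise_event (I : finType) (A : I -> set (R * R)) E :
  (forall i, measurable (E i)) -> measurable (noise_event A E).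
Proof.
move=> mE; rewrite (_ : noise_event A E = \bigcap_(i in [set: I]) (W (A i) @^-1` E i)).
  apply: fin_bigcap_measurable => // i _.
  by rewrite -[X in measurable X]setTI; exact: measurable_funP.
by apply/seteqP; split => [w wE i _|w wE i]; [exact: wE|exact: (wE i Logic.I)].
Qed.

(** Add D to the family.  The product rule, once with F and once with setT for
    the mass of D, computes both sides. *)
Lemma noise_event_disjoint_indep (I : finType) (A : I -> set (R * R)) E
    (D : set (R * R)) F :
  (forall i, noise_domain (A i)) -> trivIset setT A ->
  noise_domain D -> (forall i, A i `&` D = set0) ->
  (forall i, measurable (E i)) -> measurable F ->
  P (noise_event A E `&` W D @^-1` F) = P (noise_event A E) * P (W D @^-1` F).
Proof.
move=> dA tA dD AD mE mF.
pose A' (o : option I) := if o is Some i then A i else D.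
have dA' o : noise_domain (A' o) by case: o.
have tA' : trivIset setT A'.
  move=> [i|] [j|] _ _ //=; first by move/(tA _ _ Logic.I Logic.I) ->.
  - by rewrite AD => /set0P; rewrite eqxx.
  - by rewrite setIC AD => /set0P; rewrite eqxx.
pose E' F (o : option I) := if o is Some i then E i else F.
have mE' G o : measurable G -> measurable (E' G o).
  by move=> mG; case: o => [i|]; [exact: mE|exact: mG].
have H G : measurable G -> P (noise_event A E `&` W D @^-1` G) =
    (\prod_(o | o != None) P (W (A' o) @^-1` E' setT o)) * P (W D @^-1` G).
  move=> mG; rewrite muleC.
  have := white_noise_independent dA' tA' (fun o => mE' G o mG).
  rewrite (bigD1 None)//= => H.
  rewrite (_ : _ `&` _ = [set w | forall o, E' G o (W (A' o) w)]); last first.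
    apply/seteqP; split => w /=; first by move=> [wE wG] [i|]; [exact: wE|].
    by move=> wE; split; [move=> i; exact: (wE (Some i))|exact: (wE None)].
  by rewrite H; congr (_ * _); apply: eq_bigr => -[].
have HT := H setT measurableT.
rewrite preimage_setT setIT probability_setT mule1 in HT.
by rewrite H// HT.
Qed.

Section atoms.
Variables (I : finType) (A : I -> set (R * R)).
Hypothesis dA : forall i, noise_domain (A i).

Let sig (z : R * R) : {set I} := finset (fun i => z \in A i).

(** The points that belong to exactly the A i with i in J.  The atom of the
    empty J is replaced by the empty set, since the complement of all A i may
    have infinite area. *)
Definition atom (J : {set I}) : set (R * R) :=
  [set z | sig z = J /\ J != finset.set0].

Lemma atom_sub (J : {set I}) i : i \in J -> atom J `<=` A i.
Proof. by move=> iJ z [zJ _]; move: iJ; rewrite -zJ finset.inE inE. Qed.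

Lemma measurable_atom (J : {set I}) : measurable (atom J).
Proof.
have [->|J0] := eqVneq J finset.set0.
  by rewrite (_ : atom _ = set0)//; apply/seteqP; split => z // -[_]; rewrite eqxx.
rewrite (_ : atom J = \bigcap_(i in [set: I])
    (if i \in J then A i else ~` A i)).
  apply: fin_bigcap_measurable => // i _; have [mA _ _] := dA i.
  by case: ifP => // _; exact: measurableC.
apply/seteqP; split => [z [<- _] i _|z zJ].
  by rewrite finset.inE; case: ifPn; [rewrite inE|rewrite notin_setE].
split => //; apply/setP => i; rewrite finset.inE.
have := zJ i Logic.I; case: ifP => iJ; first by move=> zi; apply/idP; rewrite inE.
by move=> zi; apply/negP; rewrite inE.
Qed.

Lemma noise_domain_atom (J : {set I}) : noise_domain (atom J).
Proof.
have [J0|[i iJ]] := set_0Vmem J.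
  rewrite (_ : atom J = set0); first exact: noise_domain0.
  by apply/seteqP; split => z // -[_]; rewrite J0 eqxx.
by apply: (noise_domainS (dA i)); [exact: measurable_atom|exact: atom_sub].
Qed.

Lemma trivIset_atom : trivIset setT atom.
Proof. by move=> J K _ _ [z [[<- _] [<- _]]]. Qed.

Lemma atom_disjoint D (J : {set I}) : (forall i, A i `&` D = set0) -> atom J `&` D = set0.
Proof.
move=> AD; have [J0|[i iJ]] := set_0Vmem J.
  by apply/seteqP; split => z // -[[_]]; rewrite J0 eqxx.
apply/seteqP; split => z // [zJ zD].
by rewrite -(AD i); split => //; exact: (atom_sub iJ).
Qed.

Lemma bigU_atom i :
  A i = \big[setU/set0]_(J <- enum [pred J : {set I} | i \in J]) atom J.
Proof.
rewrite -bigcup_seq; apply/seteqP; split => [z zi|z [J /= iJ]]; last first.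
  by apply: atom_sub; rewrite mem_enum in iJ.
have isig : i \in sig z by rewrite finset.inE inE.
exists (sig z); first by rewrite /= mem_enum.
by split => //; apply/set0Pn; exists i.
Qed.

Lemma white_noise_atom i : {ae P, forall w,
  W (A i) w = (\sum_(J <- enum [pred J : {set I} | i \in J]) W (atom J) w)%R}.
Proof.
rewrite [in W (A i)](bigU_atom i).
have [_] := @white_noise_bigU _ (enum [pred J : {set I} | i \in J]) atom
  (enum_uniq _) noise_domain_atom trivIset_atom.
exact.
Qed.

End atoms.

(** The masses of overlapping sets are not independent of each other, but they
    are almost surely sums of masses of atoms, which are.  So the event lies,
    up to a null set, in the sigma-algebra generated by the atoms. *)
Lemma noise_event_indep (I : finType) (A : I -> set (R * R)) E
    (D : set (R * R)) F :
  (forall i, noise_domain (A i)) ->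
  noise_domain D -> (forall i, A i `&` D = set0) ->
  (forall i, measurable (E i)) -> measurable F ->
  P (noise_event A E `&` W D @^-1` F) = P (noise_event A E) * P (W D @^-1` F).
Proof.
move=> dA dD AD mE mF.
have mWD : measurable (W D @^-1` F).
  by rewrite -[X in measurable X]setTI; exact: measurable_funP.
pose boxes : set (set T) := [set G | exists E' : {set I} -> set R,
  (forall J, measurable (E' J)) /\ G = noise_event (atom A) E'].
have boxesI : setI_closed boxes.
  move=> _ _ [E1 [mE1 ->]] [E2 [mE2 ->]].
  exists (fun J => E1 J `&` E2 J); split; first by move=> J; exact: measurableI.
  by apply/seteqP; split => w; [case=> w1 w2 J; split; [exact: w1|exact: w2]
    |move=> w12; split => J; have [] := w12 J].
have mboxes : boxes `<=` measurable.
  by move=> _ [E' [mE' ->]]; exact: measurable_noise_event.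
have boxes_indep := indep_generated boxesI mboxes mWD.
pose S i w : R := (\sum_(J <- enum [pred J : {set I} | i \in J]) W (atom A J) w)%R.
pose X := [set w | forall i, E i (S i w)].
have sX : <<s boxes>> X.
  have mW J : measurable_fun setT (W (atom A J) : g_sigma_algebraType boxes -> R).
    move=> _ B mB; rewrite setTI; apply: sub_sigma_algebra.
    exists (fun K => if K == J then B else setT); split.
      by move=> K; case: ifP.
    apply/seteqP; split => [w wB K|w /(_ J)]; last by rewrite eqxx.
    by case: eqP => // ->.
  have mS i : measurable_fun setT (S i : g_sigma_algebraType boxes -> R).
    by apply: measurable_sum => J; exact: mW.
  suff : measurable (X : set (g_sigma_algebraType boxes)) by [].
  rewrite (_ : X = \bigcap_(i in [set: I]) (S i @^-1` E i)).
    apply: fin_bigcap_measurable => // i _.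
    by rewrite -[X in measurable X]setTI; exact: mS.
  by apply/seteqP; split => [w wE i _|w wE i]; [exact: wE|exact: (wE i Logic.I)].
have [mX XD] : measurable X /\ P (X `&` W D @^-1` F) = P X * P (W D @^-1` F).
  apply: boxes_indep => // _ [E' [mE' ->]].
  apply: noise_event_disjoint_indep => //.
  - exact: noise_domain_atom.
  - exact: trivIset_atom.
  - by move=> J; exact: atom_disjoint.
have mN := measurable_noise_event A mE.
have aeX : {ae P, forall w, noise_event A E w <-> X w}.
  have : {ae P, forall w, forall i, W (A i) w = S i w}.
    by apply: filter_forall => i; exact: white_noise_atom.
  apply: filterS => w wS; rewrite /X /noise_event/=.
  by split=> wE i; have := wE i; rewrite wS.
rewrite (ae_eq_set mN mX aeX) -XD; apply: ae_eq_set => //.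
- exact: measurableI.
- exact: measurableI.
by apply: filterS aeX => w aeX; split=> -[/aeX].
Qed.

(** The generators of the filtration are not stable under intersection; this
    pi-system contains them and generates the same sigma-algebra. *)
Definition past_events (a : R) : set (set T) :=
  [set G | exists (I : finType) (A : I -> set (R * R)) (E : I -> set R),
    [/\ forall i, noise_domain (A i), forall i, A i `<=` `[0%R, a] `*` setT,
        forall i, measurable (E i) & G = noise_event A E]]
  `|` [set G | measurable G /\ P G = 0].

Lemma past_eventsI a : setI_closed (past_events a).
Proof.
have null G H : measurable H -> measurable G -> P G = 0 -> P (G `&` H) = 0.
  move=> mH mG G0; apply/eqP; rewrite -measure_le0 -G0.
  by apply: le_measure; rewrite ?inE//; exact: measurableI.
have mes G : past_events a G -> measurable G.
  by move=> [[I [A [E [_ _ mE ->]]]]|[]//]; exact: measurable_noise_event.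
move=> G H pG pH; have mG := mes _ pG; have mH := mes _ pH.
case: pG => [|[_ G0]]; last first.
  by right; split; [exact: measurableI|exact: null].
case: pH => [|[_ H0] _]; last first.
  by right; split; [exact: measurableI|rewrite setIC; exact: null].
move=> [J [B [F [dB Ba mF ->]]]] [I [A [E [dA Aa mE ->]]]]; left.
exists (I + J)%type.
exists (fun k => match k with inl i => A i | inr j => B j end).
exists (fun k => match k with inl i => E i | inr j => F j end).
split; [by case|by case|by case|apply/seteqP; split].
  by move=> w [wE wF] [i|j]; [exact: wE|exact: wF].
by move=> w wEF; split => [i|j]; [exact: (wEF (inl i))|exact: (wEF (inr j))].
Qed.

Lemma noise_filtration_indep a (D : set (R * R)) F G :
  noise_domain D -> D `<=` `]a, +oo[ `*` setT -> measurable F ->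
  noise_filtration W a G ->
  measurable G /\ P (G `&` W D @^-1` F) = P G * P (W D @^-1` F).
Proof.
move=> dD Da mF.
have mWD : measurable (W D @^-1` F).
  by rewrite -[X in measurable X]setTI; exact: measurable_funP.
have past : noise_filtration W a `<=` <<s past_events a >>.
  apply: smallest_sub; first exact: smallest_sigma_algebra.
  move=> B [[A [E [dA Aa mE ->]]]|nB]; apply: sub_sigma_algebra; last by right.
  left; exists unit, (fun=> A), (fun=> E); split => //.
  by apply/seteqP; split => [w wE _|w wE]; [exact: wE|exact: (wE tt)].
move/past; apply: indep_generated => //.
- exact: past_eventsI.
- by move=> B [[I [A [E [_ _ mE ->]]]]|[]//]; exact: measurable_noise_event.
- move=> B [[I [A [E [dA Aa mE ->]]]]|[mB B0]].
    apply: noise_event_indep => // i; apply/seteqP; split => // z [/Aa[/= + _] /Da[/= + _]].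
    by rewrite !in_itv/= andbT => /andP[_ za]; rewrite ltNge za.
  rewrite B0 mul0e; apply/eqP; rewrite -measure_le0 -B0.
  by apply: le_measure; rewrite ?inE//; exact: measurableI.
Qed.

End white_noise_theory.

(** * Means of products of adapted variables and future noise *)

Section has_integral.
Local Open Scope ereal_scope.
Context {R : realType} {d : measure_display} {T : measurableType d}.
Variables (mu : {measure set T -> \bar R}) (D : set T).
Hypothesis mD : measurable D.

(** Integrability and the value of the integral travel together, so that the
    integral of a finite linear combination is found by algebra alone. *)
Definition has_integral (f : T -> R) (m : R) :=
  mu.-integrable D (EFin \o f) /\ \int[mu]_(x in D) (f x)%:E = m%:E.

Lemma has_integralD f g m n : has_integral f m -> has_integral g n ->
  has_integral (fun x => f x + g x)%R (m + n).
Proof.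
move=> [fi fm] [gi gn]; split.
  rewrite (_ : _ \o _ = (EFin \o f) \+ (EFin \o g))//; exact: integrableD.
by under eq_integral do rewrite EFinD; rewrite integralD// fm gn.
Qed.

Lemma has_integralZ f m k : has_integral f m ->
  has_integral (fun x => k * f x)%R (k * m).
Proof.
move=> [fi fm]; split.
  rewrite (_ : _ \o _ = (fun x => k%:E * (EFin \o f) x))//; exact: integrableZl.
by under eq_integral do rewrite EFinM; rewrite integralZl// fm.
Qed.

Lemma has_integral_sum (I : Type) (s : seq I) (f : I -> T -> R) m :
  (forall i, has_integral (f i) (m i)) ->
  has_integral (fun x => \sum_(i <- s) f i x)%R (\sum_(i <- s) m i).
Proof.
move=> fm; elim: s => [|i s IH].
  rewrite big_nil; split.
    rewrite (_ : _ \o _ = cst 0); first exact: integrable0.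
    by apply/funext => x /=; rewrite big_nil.
  by rewrite integral0_eq// => x _; rewrite big_nil.
rewrite big_cons (_ : (fun _ => _) = (fun x => f i x + \sum_(i <- s) f i x)%R).
  exact: has_integralD.
by apply/funext => x; rewrite big_cons.
Qed.

Lemma has_integral_ae f g m : measurable_fun D g ->
  {ae mu, forall x, f x = g x} -> has_integral f m -> has_integral g m.
Proof.
move=> mg fg [fi fm].
have fgD : ae_eq mu D (EFin \o f) (EFin \o g).
  by apply: filterS fg => x fgx _ /=; rewrite fgx.
have mf := measurable_int _ fi.
split; last first.
  rewrite -fm; apply/esym/ae_eq_integral => //; exact/measurable_EFinP.
apply/integrableP; split; first exact/measurable_EFinP.
have /integrableP[_] := fi.
congr (_ < _); apply: ge0_ae_eq_integral => //.
- exact: measurableT_comp.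
- by apply: measurableT_comp => //; exact/measurable_EFinP.
- by apply: filterS fgD => x fgx Dx; rewrite fgx.
Qed.

Lemma integrable_bounded_mul (f g : T -> R) M :
  measurable_fun D f -> (forall x, (`|f x| <= M)%R) ->
  mu.-integrable D (EFin \o g) -> mu.-integrable D (fun x => (f x * g x)%:E).
Proof.
move=> mf fM gi.
have mg : measurable_fun D g by have /measurable_int/measurable_EFinP := gi.
apply: (@le_integrable _ _ _ _ _ mD _ (fun x => M%:E * (EFin \o g) x)).
- exact/measurable_EFinP/measurable_funM.
- move=> x _ /=; rewrite lee_fin !normrM ler_wpM2r//.
  by rewrite (le_trans (fM x)) ?ler_norm.
- exact: integrableZl.
Qed.

End has_integral.

Section noise_moments.
Local Open Scope ereal_scope.
Context {R : realType} {d : measure_display} {T : measurableType d}.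
Variables (P : probability T R) (W : set (R * R) -> {RV P >-> R}).
Hypothesis hW : white_noise W.

Definition adapted_at (a : R) (X : T -> R) :=
  forall E, measurable E -> noise_filtration W a (X @^-1` E).

Lemma noise_filtration_mono (a b : R) : (a <= b)%R ->
  noise_filtration W a `<=` noise_filtration W b.
Proof.
move=> ab; apply: sub_sigma_algebra2 => G [[A [E [dA Aa mE ->]]]|]; last by right.
left; exists A, E; split => //; apply: subset_trans Aa _ => z [/= + _].
by rewrite !in_itv/= => /andP[-> /le_trans->].
Qed.

Lemma adapted_at_mono (a b : R) X : (a <= b)%R ->
  adapted_at a X -> adapted_at b X.
Proof. by move=> ab aX E mE; apply: noise_filtration_mono ab _ _; exact: aX. Qed.

Lemma noise_filtration_measurable a : noise_filtration W a `<=` measurable.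
Proof.
apply: smallest_sub => //; first exact: sigma_algebra_measurable.
move=> G [[A [F [_ _ mF ->]]]|[]//].
by rewrite -[X in measurable X]setTI; exact: measurable_funP.
Qed.

Lemma adapted_at_measurable a X : adapted_at a X -> measurable_fun setT X.
Proof.
move=> aX _ E mE; rewrite setTI.
exact: (noise_filtration_measurable (aX _ mE)).
Qed.

Lemma adapted_atM a X Y : adapted_at a X -> adapted_at a Y ->
  adapted_at a (fun w => X w * Y w)%R.
Proof.
rewrite /adapted_at /noise_filtration; set G := (X in <<s X >>) => aX aY.
have mX : measurable_fun setT (X : g_sigma_algebraType G -> R).
  by move=> _ E mE; rewrite setTI; exact: aX.
have mY : measurable_fun setT (Y : g_sigma_algebraType G -> R).
  by move=> _ E mE; rewrite setTI; exact: aY.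
by move=> E mE; have := measurable_funM mX mY measurableT mE; rewrite setTI.
Qed.

Lemma adapted_at_noise a A : noise_domain A -> A `<=` `[0%R, a] `*` setT ->
  adapted_at a (W A).
Proof.
by move=> dA Aa E mE; apply: sub_sigma_algebra; left; exists A, E.
Qed.

Lemma white_noise_moments A : noise_domain A ->
  [/\ P.-integrable setT (EFin \o W A), \int[P]_w (W A w)%:E = 0 &
      \int[P]_w (W A w ^+ 2)%:E = (fine (lebesgue2 A))%:E].
Proof.
move=> dA; have [dist _ _] := hW.
by apply: centered_gaussian_moments; [exact: fine_ge0|exact: dist].
Qed.

Section future.
Variables (a : R) (Y : T -> R).
Hypotheses (aY : adapted_at a Y) (iY : P.-integrable setT (EFin \o Y)).

Lemma adapted_future_orthogonal D :
  noise_domain D -> D `<=` `]a, +oo[ `*` setT ->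
  has_integral P setT (fun w => Y w * W D w)%R 0.
Proof.
move=> dD Da; have [iW W0 _] := white_noise_moments dD.
have mWD : measurable_fun setT (W D) by [].
have [|H1 H2] := indep_expectationM (adapted_at_measurable aY) mWD _ iY iW.
  by move=> A B mA mB; have [] := noise_filtration_indep hW dD Da mB (aY mA).
by split => //; rewrite H2 W0 mule0.
Qed.

Lemma adapted_future_sqr D m : has_integral P setT Y m ->
  noise_domain D -> D `<=` `]a, +oo[ `*` setT ->
  has_integral P setT (fun w => Y w * W D w ^+ 2)%R (m * fine (lebesgue2 D)).
Proof.
move=> [_ Ym] dD Da; have [_ _ W2] := white_noise_moments dD.
have mW2 : measurable_fun setT (fun w => W D w ^+ 2)%R.
  exact: measurable_funX.
have iW2 : P.-integrable setT (EFin \o (fun w => W D w ^+ 2)%R).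
  apply/integrableP; split; first exact/measurable_EFinP.
  under eq_integral do rewrite /= ger0_norm ?sqr_ge0//.
  by rewrite W2 ltry.
have [|H1 H2] := indep_expectationM (adapted_at_measurable aY) mW2 _ iY iW2.
  move=> A B mA mB.
  have mB2 : measurable ((fun x : R => x ^+ 2)%R @^-1` B).
    rewrite -[X in measurable X]setTI; exact: measurable_funX.
  by have [] := noise_filtration_indep hW dD Da mB2 (aY mA).
by split => //; rewrite H2 W2 Ym EFinM.
Qed.

End future.

End noise_moments.

(** * The isometry for simple processes *)

Section isometry.
Local Open Scope ereal_scope.
Context {R : realType} {d : measure_display} {T : measurableType d}.
Variables (P : probability T R) (W : set (R * R) -> {RV P >-> R}).
Hypothesis hW : white_noise W.
Local Notation vol D := (fine (lebesgue2 D)).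

Lemma fine_lebesgue2U (A B : set (R * R)) : noise_domain A -> noise_domain B ->
  A `&` B = set0 -> vol (A `|` B) = (vol A + vol B)%R.
Proof.
move=> [mA _ Afin] [mB _ Bfin] AB.
rewrite (_ : lebesgue2 (A `|` B) = lebesgue2 A + lebesgue2 B).
  by rewrite fineD// ge0_fin_numE.
exact: measureU.
Qed.

Lemma white_noiseD (A B : set (R * R)) : noise_domain A -> measurable B ->
  {ae P, forall w, W A w = (W (A `&` B) w + W (A `\` B) w)%R} /\
  vol A = (vol (A `&` B) + vol (A `\` B))%R.
Proof.
move=> dA mB; have [mA _ _] := dA.
have dI : noise_domain (A `&` B).
  by apply: (noise_domainS dA); [exact: measurableI|exact: subIsetl].
have dD : noise_domain (A `\` B).
  by apply: (noise_domainS dA); [exact: measurableD|exact: subDsetl].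
have disj : (A `&` B) `&` (A `\` B) = set0.
  by apply/seteqP; split => // z [[_ ?] []].
have AU : A = (A `&` B) `|` (A `\` B) by rewrite setUIDK.
have [_ _ /(_ _ _ dI dD disj)] := hW.
by rewrite -AU => aeW; split=> //; rewrite {1}AU fine_lebesgue2U.
Qed.

(** Polarisation reduces the product to squares: by additivity, 2 W(D) W(D')
    is almost surely W(D u D')^2 + W(D n D')^2 - W(D - D')^2 - W(D' - D)^2. *)
Lemma adapted_future_product a Y m D D' : adapted_at W a Y ->
  has_integral P setT Y m ->
  noise_domain D -> D `<=` `]a, +oo[ `*` setT ->
  noise_domain D' -> D' `<=` `]a, +oo[ `*` setT ->
  has_integral P setT (fun w => Y w * (W D w * W D' w))%R
    (m * vol (D `&` D')).
Proof.
move=> aY Ym dD Da dD' Da'; have [iY _] := Ym.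
have [mD _ _] := dD; have [mD' _ _] := dD'.
have mY := adapted_at_measurable aY.
have [aeD vD] := white_noiseD dD mD'; have [aeD' vD'] := white_noiseD dD' mD.
have dU : noise_domain (D `|` D') by exact: noise_domainU.
have Ua : D `|` D' `<=` `]a, +oo[ `*` setT by rewrite subUset.
have [aeU vU] := white_noiseD dU mD.
have UI : (D `|` D') `&` D = D by apply/setIidr; exact: subsetUl.
have UD : (D `|` D') `\` D = D' `\` D by rewrite setDUl setDv set0U.
rewrite UI UD in aeU vU; rewrite setIC in aeD' vD'.
have sub (A B : set (R * R)) : noise_domain A -> A `<=` `]a, +oo[ `*` setT ->
    measurable B -> B `<=` A ->
    has_integral P setT (fun w => Y w * W B w ^+ 2)%R (m * vol B).
  move=> dA Aa mB BA; apply: (adapted_future_sqr hW aY iY Ym).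
    exact: noise_domainS dA mB BA.
  exact: subset_trans Aa.
have hU := sub _ _ dU Ua (measurableU _ _ mD mD') (@subset_refl _ _).
have hI := sub _ _ dD Da (measurableI _ _ mD mD') (@subIsetl _ _ _).
have h1 := sub _ _ dD Da (measurableD mD mD') (@subDsetl _ _ _).
have h2 := sub _ _ dD' Da' (measurableD mD' mD) (@subDsetl _ _ _).
have := has_integralD measurableT (has_integralD measurableT hU hI)
  (has_integralD measurableT (has_integralZ measurableT (-1) h1)
                             (has_integralZ measurableT (-1) h2)).
move=> /(has_integralZ measurableT 2^-1).
rewrite (_ : 2^-1 * _ = m * vol (D `&` D'))%R; last first.
  by rewrite vU vD; field.
apply: has_integral_ae => //.
  by apply: measurable_funM => //; exact: measurable_funM.
apply: filterS3 aeD aeD' aeU => w wD wD' wU.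
by rewrite wU wD wD'; field.
Qed.

Definition elementary_box (e : @elementary R d T) : set (R * R) :=
  `]el_lo e, el_hi e] `*` el_set e.

Lemma noise_domain_box e : elementary_ok W e -> noise_domain (elementary_box e).
Proof.
move=> [/andP[lo0 lohi] [mA Afin] _ _]; split.
- exact: measurableX.
- move=> z [/= + _]; rewrite !in_itv/= andbT => /andP[+ _]; split => //=.
  by rewrite (le_trans lo0)// ltW.
- rewrite product_measure1E//; apply: lte_mul_pinfty => //.
  rewrite ge0_fin_numE//= lebesgue_measure_itv/=.
  by case: ifP => // _; rewrite -EFinB ltry.
Qed.

Lemma bounded_integrable (f : T -> R) M : measurable_fun setT f ->
  (forall w, (`|f w| <= M)%R) -> P.-integrable setT (EFin \o f).
Proof.
move=> mf fM; apply: (@le_integrable _ _ _ _ _ measurableT _ (cst M%:E)).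
- exact/measurable_EFinP.
- by move=> w _ /=; rewrite lee_fin (le_trans (fM w)) ?ler_norm.
- exact: finite_measure_integrable_cst.
Qed.

(** Cut the box that starts first at the later starting time a.  Its part
    before a joins the coefficients to form a variable that is known at time a,
    hence orthogonal to the other box; only the part after a contributes. *)
Lemma elementary_product_mean e1 e2 : elementary_ok W e1 -> elementary_ok W e2 ->
  exists m, has_integral P setT (fun w => el_coef e1 w * el_coef e2 w)%R m /\
    has_integral P setT (fun w => (el_coef e1 w * W (elementary_box e1) w) *
                                  (el_coef e2 w * W (elementary_box e2) w))%R
      (m * vol (elementary_box e1 `&` elementary_box e2)).
Proof.
wlog lo12 : e1 e2 / (el_lo e1 <= el_lo e2)%R.
  move=> H ok1 ok2; have [l12|/ltW l21] := leP (el_lo e1) (el_lo e2).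
    exact: H.
  have [m [m1 m2]] := H _ _ l21 ok2 ok1; exists m; rewrite setIC; split.
    rewrite (_ : (fun w => _) = (fun w => el_coef e2 w * el_coef e1 w)%R)//.
    by apply/funext => w; rewrite mulrC.
  by under eq_fun do rewrite mulrC.
move=> ok1 ok2; have dB1 := noise_domain_box ok1.
have dB2 := noise_domain_box ok2.
have [_ _ [M1 XM1] aX1] := ok1; have [_ _ [M2 XM2] aX2] := ok2.
have [/andP[lo10 _] _ _ _] := ok1; have [/andP[lo20 _] _ _ _] := ok2.
set B1 := elementary_box e1 in dB1 *; set B2 := elementary_box e2 in dB2 *.
pose a := el_lo e2; pose Y w := (el_coef e1 w * el_coef e2 w)%R.
have aY : adapted_at W a Y.
  by apply: adapted_atM; [exact: adapted_at_mono lo12 aX1|exact: aX2].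
have mY := adapted_at_measurable aY.
have YM w : (`|Y w| <= M1 * M2)%R by rewrite normrM ler_pM.
have iY := bounded_integrable mY YM.
have Ym : has_integral P setT Y (fine (\int[P]_w (Y w)%:E)).
  by split => //; rewrite fineK//; exact: integrable_fin_num.
exists (fine (\int[P]_w (Y w)%:E)); split; first exact: Ym.
pose N : set (R * R) := `[0%R, a] `*` setT.
have mN : measurable N by exact: measurableX.
have [mB1 _ _] := dB1; have [mB2 _ _] := dB2.
have [aeB1 _] := white_noiseD dB1 mN.
have B2a : B2 `<=` `]a, +oo[ `*` setT.
  by move=> z [/= + _]; rewrite !in_itv/= andbT => /andP[-> _].
have B1a : B1 `\` N `<=` `]a, +oo[ `*` setT.
  move=> z [[/= zB1 _] zN]; split => //=.
  move: zB1; rewrite !in_itv/= andbT => /andP[loz _].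
  rewrite ltNge; apply/negP => za; apply: zN; split => //=.
  by rewrite in_itv/= za (le_trans lo10)// ltW.
have dI : noise_domain (B1 `&` N).
  by apply: (noise_domainS dB1); [exact: measurableI|exact: subIsetl].
have dD : noise_domain (B1 `\` N).
  by apply: (noise_domainS dB1); [exact: measurableD|exact: subDsetl].
pose Z w := (Y w * W (B1 `&` N) w)%R.
have aZ : adapted_at W a Z.
  by apply: adapted_atM => //; apply: adapted_at_noise => //; exact: subIsetr.
have iZ : P.-integrable setT (EFin \o Z).
  apply: (integrable_bounded_mul measurableT mY YM).
  by have [] := white_noise_moments hW dI.
have h1 := adapted_future_orthogonal hW aZ iZ dB2 B2a.
have h2 := adapted_future_product aY Ym dD B1a dB2 B2a.
have := has_integralD measurableT h1 h2.
rewrite add0r (_ : (B1 `\` N) `&` B2 = B1 `&` B2); last first.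
  apply/seteqP; split => z [zB1 zB2]; first by split => //; case: zB1.
  split => //; split => // -[/= + _]; move: (B2a _ zB2) => [/= + _].
  by rewrite !in_itv/= andbT ltNge => /negP az /andP[_].
apply: has_integral_ae => //.
  apply: measurable_funM; apply: measurable_funM => //.
  - exact: adapted_at_measurable aX1.
  - exact: adapted_at_measurable aX2.
by apply: filterS aeB1 => w ->; rewrite /Z /Y; ring.
Qed.
Lemma measurable_positive_times : measurable (@positive_times R).
Proof. by apply: measurableX. Qed.

Lemma has_integral_indic_box (A : set (R * R)) : noise_domain A ->
  A `<=` positive_times ->
  has_integral lebesgue2 positive_times (\1_A : _ -> R) (vol A).
Proof.
move=> [mA _ Afin] A0.
have AD : A `&` positive_times = A by apply/setIidl.
have iA : \int[lebesgue2]_(z in positive_times) (\1_A z : R)%:E = lebesgue2 A.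
  rewrite integral_indic//; last exact: measurable_positive_times.
  by rewrite AD.
split; last first.
  by rewrite fineK ?ge0_fin_numE//; exact: iA.
apply/integrableP; split.
  by apply/measurable_EFinP/measurable_funTS; exact: measurable_indic.
under eq_integral do rewrite /= ger0_norm//.
by rewrite [ltLHS]iA.
Qed.

Section simple_processes.
Variables (n : nat) (phi : 'I_n -> @elementary R d T).
Hypothesis ok : forall i, elementary_ok W (phi i).
Let B i := elementary_box (phi i).
Let X i := el_coef (phi i).

(** Expanding the squares, both E S^2 and the norm are the double sum of
    E (X_i X_j) times the area of the intersection of the boxes i and j. *)
Lemma simple_isometry : exists r : R,
  [/\ has_integral P setT (simple_int W phi) 0,
      has_integral P setT (fun w => simple_int W phi w ^+ 2)%R r &
      field_norm2 P (simple_val phi) = r%:E].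
Proof.
have [m mP] := choice (fun ij : 'I_n * 'I_n =>
  elementary_product_mean (ok ij.1) (ok ij.2)).
exists (\sum_i \sum_j m (i, j) * vol (B i `&` B j))%R; split.
- rewrite (_ : 0%R = \sum_(i < n) 0)%R; last by rewrite big1.
  apply: has_integral_sum => // i; have [_ _ [M XM] aX] := ok i.
  apply: (adapted_future_orthogonal hW aX) => //.
  + exact: bounded_integrable (adapted_at_measurable aX) XM.
  + exact: noise_domain_box.
  + by move=> z [/= + _]; rewrite !in_itv/= andbT => /andP[-> _].
- under eq_fun do rewrite expr2 big_distrlr/=.
  do 2 (apply: has_integral_sum => // ?).
  exact: (mP (_, _)).2.
rewrite /field_norm2.
have norm w :
    \int[lebesgue2]_(z in positive_times) (simple_val phi z.1 z.2 w ^+ 2)%:E =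
    (\sum_i \sum_j (X i w * X j w) * vol (B i `&` B j))%:E.
  have vB i j : noise_domain (B i `&` B j) /\ B i `&` B j `<=` positive_times.
    have dBi := noise_domain_box (ok i); have [/andP[lo0 _] _ _ _] := ok i.
    split.
      apply: (noise_domainS dBi); last exact: subIsetl.
      by apply: measurableI; [have [] := dBi|have [] := noise_domain_box (ok j)].
    move=> z [[/= + _] _]; rewrite !in_itv/= => /andP[loz _].
    by split => //=; rewrite in_itv/= andbT (le_lt_trans lo0).
  have [_ <-] : has_integral lebesgue2 positive_times
      (fun z => \sum_i \sum_j (X i w * X j w) * \1_(B i `&` B j) z)%R
      (\sum_i \sum_j (X i w * X j w) * vol (B i `&` B j)).
    apply: has_integral_sum => [|i]; first exact: measurable_positive_times.
    apply: has_integral_sum => [|j]; first exact: measurable_positive_times.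
    apply: has_integralZ; first exact: measurable_positive_times.
    by apply: has_integral_indic_box; apply vB.
  apply: eq_integral => z _; congr EFin.
  rewrite expr2 /simple_val big_distrlr/=.
  apply: eq_bigr => i _; apply: eq_bigr => j _.
  have boxE k : \1_(B k) z = (\1_(`]el_lo (phi k), el_hi (phi k)]) z.1 *
      \1_(el_set (phi k)) z.2)%R :> R.
    by rewrite !indicE in_setX -natrM mulnb.
  by rewrite indicI /= !boxE /X; ring.
under eq_integral do rewrite norm.
have [] // : has_integral P setT
  (fun w => \sum_i \sum_j (X i w * X j w) * vol (B i `&` B j))%R
  (\sum_i \sum_j m (i, j) * vol (B i `&` B j)).
do 2 (apply: has_integral_sum => // ?).
rewrite mulrC; under eq_fun do rewrite mulrC.
apply: has_integralZ => //; exact: (mP (_, _)).1.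
Qed.

End simple_processes.
End isometry.

(** * A lower bound for second moments of Walsh integrals *)

Section perturbation.
Local Open Scope ereal_scope.
Context {R : realType} {d : measure_display} {T : measurableType d}.
Variables (mu : {measure set T -> \bar R}) (D : set T).
Hypothesis mD : measurable D.

(** The difference of the two sides is (e y - (x - y))^2 / e. *)
Lemma sqr_le_perturbed (e x y : R) : (0 < e)%R ->
  (x ^+ 2 <= (1 + e) * y ^+ 2 + (1 + e^-1) * (x - y) ^+ 2)%R.
Proof.
move=> e0; rewrite -subr_ge0.
rewrite (_ : _ - _ = e^-1 * (e * y - (x - y)) ^+ 2)%R; last first.
  by field; rewrite gt_eqF.
by rewrite mulr_ge0 ?sqr_ge0// invr_ge0 ltW.
Qed.

Lemma integral_sqr_le_perturbed (e : R) (g h : T -> R) : (0 < e)%R ->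
  measurable_fun D g -> measurable_fun D h ->
  \int[mu]_(x in D) (g x ^+ 2)%:E <=
  (1 + e)%:E * \int[mu]_(x in D) (h x ^+ 2)%:E +
  (1 + e^-1)%:E * \int[mu]_(x in D) ((g x - h x) ^+ 2)%:E.
Proof.
move=> e0 mg mh.
have e1 : (0 <= 1 + e)%R by rewrite addr_ge0// ltW.
have e2 : (0 <= 1 + e^-1)%R by rewrite addr_ge0// invr_ge0 ltW.
have m1 : measurable_fun D (fun x => (h x ^+ 2)%:E).
  by apply/measurable_EFinP; exact: measurable_funX.
have m2 : measurable_fun D (fun x => ((g x - h x) ^+ 2)%:E).
  by apply/measurable_EFinP; apply: measurable_funX; exact: measurable_funB.
have p1 x : D x -> 0 <= (h x ^+ 2)%:E by rewrite lee_fin sqr_ge0.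
have p2 x : D x -> 0 <= ((g x - h x) ^+ 2)%:E by rewrite lee_fin sqr_ge0.
rewrite -!ge0_integralZl_EFin//.
rewrite -ge0_integralD//; last 4 first.
- by move=> x Dx; rewrite mule_ge0 ?p1.
- exact: measurable_funeM.
- by move=> x Dx; rewrite mule_ge0 ?p2.
- exact: measurable_funeM.
apply: ge0_le_integral => //.
- by move=> x _; rewrite lee_fin sqr_ge0.
- by apply/measurable_EFinP; exact: measurable_funX.
- by apply: emeasurable_funD; exact: measurable_funeM.
- by move=> x _; rewrite -!EFinM -EFinD lee_fin; exact: sqr_le_perturbed.
Qed.

End perturbation.

Section lebesgue_plane.
Context {R : realType}.
Local Open Scope ereal_scope.
Let rT := measurableTypeR R.

Lemma sigma_finite_lebesgue2 : sigma_finite setT (lebesgue2 : set (rT * rT) -> \bar R).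
Proof.
pose I (n : nat) : set R := `[(- n%:R)%R, n%:R%R]%classic.
have Ifin n : lebesgue_measure (I n) < +oo.
  by rewrite /I lebesgue_measure_itv/=; case: ifP => // _; rewrite -EFinB ltry.
have Ige n m (x : R) : (n <= m)%N -> (`|x| < n%:R)%R -> I m x.
  move=> nm xn; rewrite /I/= in_itv/= -ler_norml (le_trans (ltW xn))//.
  by rewrite ler_nat.
exists (fun n => I n `*` I n).
  apply/seteqP; split => // -[x y] _ /=.
  exists (maxn (Num.bound `|x|) (Num.bound `|y|)) => //; split => /=.
    by apply: Ige (leq_maxl _ _) _; exact: archi_boundP.
  by apply: Ige (leq_maxr _ _) _; exact: archi_boundP.
move=> n; split; first by apply: measurableX; exact: measurable_itv.
rewrite product_measure1E//; last 2 first.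
  exact: measurable_itv.
  exact: measurable_itv.
by rewrite lte_mul_pinfty ?ge0_fin_numE ?measure_ge0 ?Ifin.
Qed.

(** Carries the sigma-finiteness of the product measure, on which Tonelli's
    theorem depends. *)
Definition lebesgue_plane : set (rT * rT) -> \bar R :=
  (@lebesgue_measure R \x @lebesgue_measure R).
HB.instance Definition _ := Measure.copy lebesgue_plane
  (@lebesgue_measure R \x @lebesgue_measure R).
HB.instance Definition _ := Measure_isSigmaFinite.Build _ _ _
  lebesgue_plane sigma_finite_lebesgue2.
End lebesgue_plane.

Section random_fields.
Local Open Scope ereal_scope.
Context {R : realType} {d : measure_display} {T : measurableType d}.
Variables (P : probability T R) (W : set (R * R) -> {RV P >-> R}).

Local Notation space_time_events := (positive_times `*` [set: T]).

Definition measurable_field (f : R -> R -> T -> R) :=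
  measurable_fun (space_time_events : set (R * R * T))
    (fun p : R * R * T => f p.1.1 p.1.2 p.2).

Lemma measurable_space_time_events :
  measurable (space_time_events : set (R * R * T)).
Proof. by apply: measurableX => //; exact: measurable_positive_times. Qed.

(** Joint measurability is what Tonelli's theorem asks for. *)
Lemma predictable_measurable f : predictable W f -> measurable_field f.
Proof.
move=> pf _ E mE; have := pf E mE; apply: smallest_sub.
  split; first exact: measurable0.
    by move=> A mA; apply: measurableD => //; exact: measurable_space_time_events.
  by move=> F mF; exact: bigcup_measurable.
move=> Q [a [b [A [G [a0 mA FG ->]]]]].
apply: measurableX; first by apply: measurableX => //; exact: measurable_itv.
apply: (noise_filtration_measurable FG).
Qed.

Lemma measurable_field_sub f g : measurable_field f -> measurable_field g ->
  measurable_field (fun s y w => f s y w - g s y w)%R.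
Proof. by move=> mf mg; exact: measurable_funB. Qed.

Lemma measurable_field_simple_val n (phi : 'I_n -> @elementary R d T) :
  (forall i, elementary_ok W (phi i)) -> measurable_field (simple_val phi).
Proof.
move=> ok; apply: measurable_funTS.
apply: measurable_sum => i; have [_ [mA _] _ aX] := ok i.
have mX := adapted_at_measurable aX.
have m1 : measurable_fun setT (fun p : R * R * T => p.1.1).
  by apply: (measurableT_comp measurable_fst); exact: measurable_fst.
have m2 : measurable_fun setT (fun p : R * R * T => p.1.2).
  by apply: (measurableT_comp measurable_snd); exact: measurable_fst.
have mlo : measurable_fun setT (\1_(`]el_lo (phi i), el_hi (phi i)]) : R -> R).
  by apply: measurable_indic; exact: measurable_itv.
have mset : measurable_fun setT (\1_(el_set (phi i)) : R -> R).
  exact: measurable_indic.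
apply: measurable_funM; first apply: measurable_funM.
- by apply: (measurableT_comp mX); exact: measurable_snd.
- exact: (measurableT_comp mlo m1).
- exact: (measurableT_comp mset m2).
Qed.

Section tonelli.
Variable f : R -> R -> T -> R.
Hypothesis mf : measurable_field f.

Let F (p : R * R * T) : \bar R :=
  ((fun p : R * R * T => (f p.1.1 p.1.2 p.2 ^+ 2)%:E) \_ space_time_events) p.

Let mF : measurable_fun setT F.
Proof.
apply/(measurable_restrictT _ measurable_space_time_events).
by apply/measurable_EFinP; exact: measurable_funX.
Qed.

Let F0 p : 0 <= F p.
Proof. by rewrite /F patchE; case: ifPn => // _; rewrite lee_fin sqr_ge0. Qed.

Let FE z w : F (z, w) =
  ((fun z : R * R => (f z.1 z.2 w ^+ 2)%:E) \_ positive_times) z.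
Proof.
rewrite /F !patchE.
have -> : ((z, w) \in space_time_events) = (z \in positive_times).
  by rewrite in_setX /= in_setT andbT.
by [].
Qed.

(** As a single integral over the product space, the norm falls under the
    perturbation inequality above. *)
Lemma field_norm2_product : field_norm2 P f =
  \int[lebesgue2 \x P]_(p in space_time_events) (f p.1.1 p.1.2 p.2 ^+ 2)%:E.
Proof.
transitivity (\int[P]_w \int[lebesgue2]_z F (z, w)).
  apply: eq_integral => w _; rewrite integral_mkcond.
  by apply: eq_integral => z _; rewrite FE.
transitivity (\int[lebesgue2 \x P]_p F p); last by rewrite [RHS]integral_mkcond.
exact: (esym (@fubini_tonelli2 _ _ _ _ R (@lebesgue_plane R) P F mF F0)).
Qed.

Lemma field_norm2_swap : field_norm2 P f =
  \int[lebesgue2]_(z in positive_times) \int[P]_w (f z.1 z.2 w ^+ 2)%:E.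
Proof.
rewrite field_norm2_product.
transitivity (\int[lebesgue2 \x P]_p F p); first by rewrite [LHS]integral_mkcond.
transitivity (\int[lebesgue2]_z \int[P]_w F (z, w)).
  exact: (@fubini_tonelli1 _ _ _ _ R (@lebesgue_plane R) P F mF F0).
rewrite [RHS]integral_mkcond; apply: eq_integral => z _.
rewrite patchE; under eq_integral do rewrite FE patchE.
by case: ifPn => // _; rewrite integral0.
Qed.

Lemma measurable_field_section s y : (0 < s)%R -> measurable_fun setT (f s y).
Proof.
move=> s0; rewrite (_ : f s y =
  (fun p : R * R * T => f p.1.1 p.1.2 p.2) \o (fun w => ((s, y), w)))//.
apply: (measurable_comp measurable_space_time_events _ mf).
  by move=> _ [w _ <-]; split => //; split => //=; rewrite in_itv/= s0.
exact: measurable_pair1.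
Qed.

Lemma measurable_field_sqr_mean :
  measurable_fun (@positive_times R) (fun z => \int[P]_w (f z.1 z.2 w ^+ 2)%:E).
Proof.
have := @measurable_fun_fubini_tonelli_F _ _ _ _ R P F mF F0.
move=> /(measurable_funS measurableT (@subsetT _ positive_times)).
apply: eq_measurable_fun => z zD; rewrite /fubini_F.
by apply: eq_integral => w _; rewrite FE patchE zD.
Qed.

End tonelli.

Lemma field_norm2_le_perturbed (e : R) f g : (0 < e)%R ->
  measurable_field f -> measurable_field g ->
  field_norm2 P f <= (1 + e)%:E * field_norm2 P g +
    (1 + e^-1)%:E * field_norm2 P (fun s y w => g s y w - f s y w)%R.
Proof.
move=> e0 mf mg.
rewrite (field_norm2_product mf) (field_norm2_product mg).
rewrite (field_norm2_product (measurable_field_sub mg mf)).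
under [X in _ + _ * X]eq_integral do rewrite -sqrrN opprB.
exact: (integral_sqr_le_perturbed (lebesgue2 \x P) measurable_space_time_events e0 mf mg).
Qed.

Hypothesis hW : white_noise W.

(** A simple integral S is centred, so E (c + S)^2 is c^2 plus the squared norm
    of its integrand.  Perturbing S into I and the simple integrand into f costs
    a factor 1 + e each and errors that vanish along the approximation; then e
    tends to 0. *)
Lemma walsh_second_moment f I (c : R) : walsh_integral W f I ->
  (c ^+ 2)%:E + field_norm2 P f <= \int[P]_w ((c + I w) ^+ 2)%:E.
Proof.
move=> [pf ffin mI [m [phi [ok phif phiI]]]].
have mf := predictable_measurable pf.
have f0 : 0 <= field_norm2 P f.
  by apply: integral_ge0 => w _; apply: integral_ge0 => z _; rewrite lee_fin sqr_ge0.
have I0 : 0 <= \int[P]_w ((c + I w) ^+ 2)%:E.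
  by apply: integral_ge0 => w _; rewrite lee_fin sqr_ge0.
have [->|Iy] := eqVneq (\int[P]_w ((c + I w) ^+ 2)%:E) +oo; first exact: leey.
have Ifin : \int[P]_w ((c + I w) ^+ 2)%:E \is a fin_num.
  by rewrite ge0_fin_numE// lt_neqAle Iy leey.
have ffin' : field_norm2 P f \is a fin_num by rewrite ge0_fin_numE.
have step e : (0 < e)%R -> (c ^+ 2 + fine (field_norm2 P f) <=
    (1 + e) * ((1 + e) * fine (\int[P]_w ((c + I w) ^+ 2)%:E) + e) + e)%R.
  move=> e0; have k0 : (0 < 1 + e^-1)%R by rewrite addr_gt0// invr_gt0.
  have k1 : (0 <= 1 + e)%R by rewrite addr_ge0// ltW.
  have eta0 : 0 < (e / (1 + e^-1))%:E by rewrite lte_fin divr_gt0.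
  have small (u : nat -> \bar R) : u n @[n --> \oo] --> 0 ->
      \forall n \near \oo, u n < (e / (1 + e^-1))%:E.
    by move=> u0; exact: (u0 _ (open_ereal_lt' eta0)).
  have [n [dn en]] : exists n,
      field_norm2 P (fun s y w => simple_val (phi n) s y w - f s y w)%R <
        (e / (1 + e^-1))%:E /\
      \int[P]_w ((simple_int W (phi n) w - I w) ^+ 2)%:E < (e / (1 + e^-1))%:E.
    have [N _ NP] := filterI (small _ phif) (small _ phiI).
    exists N; have [H1 H2] := NP N (leqnn N); split; first exact: H1.
    by move: H2; rewrite unlock.
  have scale (x : \bar R) : x < (e / (1 + e^-1))%:E -> (1 + e^-1)%:E * x <= e%:E.
    move=> /ltW xe; apply: (@le_trans _ _ ((1 + e^-1)%:E * (e / (1 + e^-1))%:E)).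
      by rewrite lee_pmul2l// lte_fin.
    by rewrite -EFinM lee_fin mulrC divfK// gt_eqF.
  have [r [S1 S2 Sr]] := simple_isometry hW (ok n).
  have mS : measurable_fun setT (simple_int W (phi n)).
    by have [/measurable_int/measurable_EFinP] := S1.
  have cS : \int[P]_w ((c + simple_int W (phi n) w) ^+ 2)%:E = (c ^+ 2 + r)%:E.
    have hc : has_integral P setT (cst (c ^+ 2))%R (c ^+ 2).
      split; first exact: finite_measure_integrable_cst.
      rewrite (@integral_cst _ _ _ P setT measurableT (c ^+ 2)%:E).
      by rewrite -[RHS]mule1; congr (_ * _); exact: probability_setT.
    have [_] := has_integralD measurableT hc
      (has_integralD measurableT (has_integralZ measurableT (2 * c) S1) S2).
    rewrite mulr0 add0r => <-; apply: eq_integral => w _; congr EFin.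
    by rewrite /=; ring.
  have r1 : (c ^+ 2 + r <= (1 + e) * fine (\int[P]_w ((c + I w) ^+ 2)%:E) + e)%R.
    rewrite -lee_fin -cS EFinD EFinM fineK//.
    apply: le_trans (integral_sqr_le_perturbed P measurableT e0
      (measurable_funD (measurable_cst c) mS)
      (measurable_funD (measurable_cst c) mI)) _.
    apply: leeD2l; apply: scale.
    by under eq_integral do rewrite /= opprD addrACA subrr add0r.
  have r2 : (fine (field_norm2 P f) <= (1 + e) * r + e)%R.
    rewrite -lee_fin fineK// EFinD EFinM -Sr.
    apply: le_trans (field_norm2_le_perturbed e0 mf
      (measurable_field_simple_val (ok n))) _.
    by apply: leeD2l; exact: scale.
  have := ler_wpM2l k1 r1; have := sqr_ge0 c.
  by move: r2 (e0); nra.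
rewrite -(fineK Ifin) -(fineK ffin') -EFinD lee_fin.
move: step (fine_ge0 I0); move: (fine _) (fine _) => b a step a0.
rewrite leNgt; apply/negP => ab.
pose g := (c ^+ 2 + a - b)%R.
have g0 : (0 < g)%R by rewrite subr_gt0.
(* for e <= 1 the bound of step is at most b + 3 e (b + 1) *)
pose e := Num.min 1%R (g / (6 * (b + 1)))%R.
have b1 : (0 < 6 * (b + 1))%R by rewrite mulr_gt0// ltr_wpDl.
have e0 : (0 < e)%R by rewrite lt_min ltr01 divr_gt0.
have e1 : (e <= 1)%R by rewrite ge_min lexx.
have eg : (e * (6 * (b + 1)) <= g)%R by rewrite -ler_pdivlMr// ge_min lexx orbT.
have := step e e0; rewrite /g in eg g0; nra.
Qed.

End random_fields.

(** * The light cone and the renewal inequality *)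

Section light_cone.
Local Open Scope ereal_scope.
Context {R : realType}.
Local Notation mu := (@lebesgue_measure R).
Variables (kappa t x : R).
Hypothesis kappa0 : (0 < kappa)%R.

Definition light_cone : set (R * R) :=
  [set z | (0 < z.1 <= t)%R /\ (`|z.2 - x| <= kappa * (t - z.1))%R].

Lemma measurable_light_cone : measurable light_cone.
Proof.
have m1 : measurable_fun setT (fun z : R * R => z.1) by exact: measurable_fst.
have m2 : measurable_fun setT (fun z : R * R =>
    kappa * (t - z.1) - `|z.2 - x|)%R.
  apply: measurable_funB.
    apply: measurable_funM => //; exact: measurable_funB.
  apply: measurableT_comp; first exact: normr_measurable.
  by apply: measurable_funB => //; exact: measurable_snd.
rewrite (_ : light_cone = (fst @^-1` `]0%R, t]) `&`
  ((fun z => kappa * (t - z.1) - `|z.2 - x|)%R @^-1` `[0%R, +oo[)).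
  apply: measurableI; rewrite -[X in measurable X]setTI; [exact: m1|exact: m2].
by apply/seteqP; split => z; rewrite /light_cone/= !in_itv/= andbT subr_ge0.
Qed.

Lemma wave_kernel_cone (s y : R) : (0 < s)%R ->
  ((\1_`]0%R, t] s * wave_kernel kappa (t - s) (y - x)) ^+ 2 =
  4^-1 * \1_light_cone (s, y))%R.
Proof.
move=> s0; rewrite /wave_kernel !indicE.
have -> : ((s, y) \in light_cone) =
    (s \in `]0%R, t]%classic) && ((y - x)%R \in
      `[(- (kappa * (t - s)))%R, (kappa * (t - s))%R]%classic).
  by rewrite !mem_setE !in_itv /= -ler_norml; apply/asboolP/andP.
case: (_ \in _); case: (_ \in _); rewrite ?mulr0 ?mul0r ?expr0n ?mulr0//=.
by rewrite !mul1r !mulr1; field.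
Qed.

(** The section of the cone at time s is an interval of length
    2 kappa (t - s). *)
Lemma integral_light_cone (q : R -> R) :
  measurable_fun setT q -> (forall s, (0 <= q s)%R) ->
  \int[lebesgue2]_(z in positive_times) (\1_light_cone z * q z.1)%:E =
  \int[mu]_(s in `]0%R, t]) (2 * kappa * (t - s) * q s)%:E.
Proof.
move=> mq q0.
pose F (z : R * R) : \bar R := (\1_light_cone z * q z.1)%:E.
have mF : measurable_fun setT F.
  apply/measurable_EFinP; apply: measurable_funM.
    by apply: measurable_indic; exact: measurable_light_cone.
  by apply: (measurableT_comp mq); exact: measurable_fst.
have F0 z : 0 <= F z by rewrite lee_fin mulr_ge0.
have out z : ~ light_cone z -> F z = 0.
  by move=> nz; rewrite /F indicE memNset// mul0r.
transitivity (\int[lebesgue2]_z F z).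
  rewrite integral_mkcond; apply: eq_integral => z _; rewrite patchE.
  case: ifPn => // nz; apply/esym/out => -[/andP[z0 _] _].
  by move: nz; rewrite notin_setE; apply; split => //=; rewrite in_itv/= z0.
rewrite (@fubini_tonelli1 _ _ _ _ R mu mu F mF F0).
rewrite [RHS]integral_mkcond; apply: eq_integral => s _.
rewrite patchE /fubini_F; case: ifPn => st; last first.
  apply: integral0_eq => y _; apply: out => -[/= s0 _].
  by move: st; rewrite notin_setE; apply; rewrite /= in_itv.
have {}st : (0 < s <= t)%R by move: st; rewrite inE /= in_itv.
have ts : (0 <= t - s)%R by rewrite subr_ge0; case/andP: st.
pose I : set R := `[(x - kappa * (t - s))%R, (x + kappa * (t - s))%R]%classic.
transitivity (\int[mu]_y ((q s)%:E * (\1_I y : R)%:E)).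
  apply: eq_integral => y _; rewrite /F /= -EFinM mulrC !indicE.
  have -> // : ((s, y) \in light_cone) = (y \in I).
  rewrite /I !mem_setE in_itv/= -ler_distl; apply/asboolP/idP => [[]//|yx].
  by split.
have mI : measurable_fun setT (fun y : R => (\1_I y : R)%:E).
  by apply/measurable_EFinP; apply: measurable_indic; exact: measurable_itv.
have I0 (y : R) : setT y -> 0 <= (\1_I y : R)%:E by rewrite lee_fin.
rewrite (ge0_integralZl_EFin mu measurableT I0 mI (q0 s)).
rewrite integral_indic; [|exact: measurableT|exact: measurable_itv].
rewrite setIT /= lebesgue_measure_itv/= lte_fin.
have kts : (0 <= kappa * (t - s))%R by rewrite mulr_ge0// ltW.
case: ltP => xx; first by rewrite -EFinB -EFinM; congr EFin; ring.
have k0 : (kappa * (t - s) = 0)%R by lra.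
by rewrite -(mulrA 2%R) k0 mulr0 mul0r mule0.
Qed.

End light_cone.

Section energy.
Local Open Scope ereal_scope.
Context {R : realType} {d : measure_display} {T : measurableType d}.
Variables (P : probability T R) (W : set (R * R) -> {RV P >-> R}).
Variables (kappa : R) (sg u0 v0 : R -> R) (u : R -> R -> T -> R).
Hypotheses (hW : white_noise W) (kappa0 : (0 < kappa)%R).
Hypotheses (u0_ge0 : forall x, (0 <= u0 x)%R) (v0_ge0 : forall x, (0 <= v0 x)%R).
Hypothesis hu : mild_solution W kappa sg u0 v0 u.
Local Notation L := (L_lower sg).
Local Notation m0 := (inf (range u0)).
Hypotheses (m0_gt0 : (0 < m0)%R) (L_gt0 : (0 < L)%R).

Lemma L_lower_sqr (x : R) : ((L * x) ^+ 2 <= sg x ^+ 2)%R.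
Proof.
have [->|x0] := eqVneq x 0%R; first by rewrite mulr0 expr0n/= sqr_ge0.
have Lx : (L <= `|sg x / x|)%R.
  apply: ge_inf; first by exists 0%R => _ [y _ <-]; exact: normr_ge0.
  by exists x.
rewrite -ler_sqrt ?sqr_ge0// !sqrtr_sqr normrM gtr0_norm//.
by rewrite -ler_pdivlMr ?normr_gt0// -normfV -normrM.
Qed.

Lemma wave_free_ge (t x : R) : (m0 <= wave_free kappa u0 v0 t x)%R.
Proof.
have u0m y : (m0 <= u0 y)%R.
  by apply: ge_inf; [exists 0%R => _ [z _ <-]|exists y].
rewrite /wave_free; set v := Rintegral _ _ _.
have v_ge0 : (0 <= v)%R by apply: Rintegral_ge0.
have := u0m (x + kappa * t)%R; have := u0m (x - kappa * t)%R; lra.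
Qed.

(** One step of the iteration: the deterministic part contributes at least
    inf u0 squared, and the Walsh integral at least the integral of L^2 p / 4
    over the light cone, since the squared wave kernel is 1/4 there. *)
Lemma second_moment_ge (p : R -> R) (t x : R) : (0 < t)%R ->
  measurable_fun setT p -> (forall s, (0 <= p s)%R) ->
  (forall s y, (0 < s)%R -> (p s)%:E <= \int[P]_w (u s y w ^+ 2)%:E) ->
  (m0 ^+ 2)%:E +
    \int[lebesgue_measure]_(s in `]0%R, t])
      (L ^+ 2 * (kappa / 2) * ((t - s) * p s))%:E
  <= \int[P]_w (u t x w ^+ 2)%:E.
Proof.
move=> t0 mp p0 hp; have [pu _ /(_ t x t0)[I [wI aeI]]] := hu.
have mu := predictable_measurable pu.
have [pf _ mI _] := wI; have mf := predictable_measurable pf.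
set J := wave_free kappa u0 v0 t x in aeI *.
have mut := measurable_field_section mu x t0.
have -> : \int[P]_w (u t x w ^+ 2)%:E = \int[P]_w ((J + I w) ^+ 2)%:E.
  apply: ge0_ae_eq_integral => //.
  - by apply/measurable_EFinP; apply: measurable_funX.
  - by apply/measurable_EFinP; apply: measurable_funX; exact: measurable_funD.
  - by move=> w _; rewrite lee_fin sqr_ge0.
  - by move=> w _; rewrite lee_fin sqr_ge0.
  - by apply: filterS aeI => w uw _; rewrite uw.
apply: le_trans (walsh_second_moment hW J wI).
apply: leeD.
  rewrite lee_fin ler_sqr ?nnegrE; first exact: wave_free_ge.
    exact: ltW.
  exact: le_trans (ltW m0_gt0) (wave_free_ge _ _).
rewrite (field_norm2_swap P mf).
pose q s := (L ^+ 2 / 4 * p s)%R.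
have mq : measurable_fun setT q by exact: measurable_funM.
have q0 s : (0 <= q s)%R by rewrite mulr_ge0// divr_ge0// sqr_ge0.
have -> : \int[lebesgue_measure]_(s in `]0%R, t])
      (L ^+ 2 * (kappa / 2) * ((t - s) * p s))%:E =
    \int[lebesgue2]_(z in positive_times) (\1_(light_cone kappa t x) z * q z.1)%:E.
  rewrite integral_light_cone//; apply: eq_integral => s _; congr EFin.
  by rewrite /q; field.
apply: ge0_le_integral.
- exact: measurable_positive_times.
- by move=> z _; rewrite lee_fin mulr_ge0.
- apply/measurable_funTS/measurable_EFinP; apply: measurable_funM.
    by apply: measurable_indic; exact: measurable_light_cone.
  by apply: (measurableT_comp mq); exact: measurable_fst.
- have mean := measurable_field_sqr_mean P mf.
  exact mean.
move=> [s y] [/= + _]; rewrite in_itv/= andbT => s0.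
set k := (\1_`]0%R, t] s * wave_kernel kappa (t - s) (y - x))%R.
apply: (@le_trans _ _ ((k ^+ 2 * L ^+ 2)%:E * \int[P]_w (u s y w ^+ 2)%:E)).
  apply: (@le_trans _ _ ((k ^+ 2 * L ^+ 2)%:E * (p s)%:E)).
    by rewrite -EFinM lee_fin /k wave_kernel_cone// /q; lra.
  by apply: lee_wpmul2l; [rewrite lee_fin mulr_ge0 ?sqr_ge0|exact: hp].
have mus := measurable_field_section mu y s0.
have mfs := measurable_field_section mf y s0.
have u2_ge0 w : setT w -> 0 <= (u s y w ^+ 2)%:E by rewrite lee_fin sqr_ge0.
have mu2 : measurable_fun setT (fun w => (u s y w ^+ 2)%:E).
  by apply/measurable_EFinP; exact: measurable_funX.
have kL : (0 <= k ^+ 2 * L ^+ 2)%R by rewrite mulr_ge0 ?sqr_ge0.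
rewrite -(ge0_integralZl_EFin P measurableT u2_ge0 mu2 kL).
apply: ge0_le_integral => //.
- by move=> w _; apply: mule_ge0; [rewrite lee_fin|exact: u2_ge0].
- exact: measurable_funeM.
- by apply/measurable_EFinP; exact: measurable_funX.
move=> w _; rewrite -EFinM lee_fin /= -/k.
have -> : (k ^+ 2 * L ^+ 2 * u s y w ^+ 2 = k ^+ 2 * (L * u s y w) ^+ 2)%R by ring.
rewrite [in leRHS]exprMn.
by apply: ler_wpM2l; [exact: sqr_ge0|exact: L_lower_sqr].
Qed.

End energy.

(** * Exponential growth *)

Section cosh_series.
Context {R : realType}.
Local Notation mu := (@lebesgue_measure R).

(** Convolution with the identity function is a double antiderivative. *)
Lemma has_integral_wave_monomial (k : nat) (t : R) : 0 < t ->
  has_integral mu `]0, t]%classic (fun s => (t - s) * (s ^+ k / k`!%:R))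
    (t ^+ k.+2 / k.+2`!%:R).
Proof.
move=> t0; pose f (s : R) := (t - s) * (s ^+ k / k`!%:R).
have fac n : n`!%:R != 0 :> R by rewrite pnatr_eq0 -lt0n fact_gt0.
pose a : R := t / k.+1`!%:R; pose b : R := k.+1%:R / k.+2`!%:R.
pose F (s : R) := a * s ^+ k.+1 - b * s ^+ k.+2.
have dX (n : nat) (r : R) : is_derive r 1 (fun s : R => s ^+ n) (n%:R * r ^+ n.-1).
  apply: DeriveDef; first exact: exprn_derivable.
  by rewrite exp_derive; exact: mulr1.
have dF (r : R) : is_derive r 1 F (f r).
  have := is_deriveB (is_deriveZ a (dX k.+1 r)) (is_deriveZ b (dX k.+2 r)).
  congr is_derive; rewrite /GRing.scale /= /f /a /b !factS !natrM exprS.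
  have k1 : k.+1%:R != 0 :> R by rewrite pnatr_eq0.
  have k2 : k.+2%:R != 0 :> R by rewrite pnatr_eq0.
  move: (fac k) k1 k2; move: (k`!%:R) (k.+1%:R) (k.+2%:R) (r ^+ k) => x y z p *.
  by field; do !(apply/andP; split).
have cf : continuous f.
  move=> s; apply: cvgM; first by apply: cvgB; [exact: cvg_cst|exact: cvg_id].
  by apply: cvgM; [exact: exprn_continuous|exact: cvg_cst].
have cF : continuous F.
  move=> s; apply: differentiable_continuous; apply/derivable1_diffP.
  by have [] := dF s.
have iF : mu.-integrable `[0, t]%classic (EFin \o f).
  apply: continuous_compact_integrable; first exact: segment_compact.
  exact: continuous_subspaceT.
split.
  apply: integrableS iF => //; exact: subset_itv_oc_cc.
rewrite integral_itv_obnd_cbnd; last first.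
  apply: measurable_funTS; apply/measurable_EFinP.
  exact: continuous_measurable_fun.
rewrite (@continuous_FTC2 _ f F) //; last 3 first.
- exact: continuous_subspaceT.
- split.
  + by move=> s _; have [] := dF s.
  + exact/cvg_at_right_filter/cF.
  + exact/cvg_at_left_filter/cF.
- by move=> s _; rewrite derive1E; have [] := dF s.
rewrite -EFinB; congr EFin; rewrite /F !expr0n /= !mulr0 subrr subr0 /a /b.
have k1 : k.+1%:R != 0 :> R by rewrite pnatr_eq0.
have k2 : 1 + k.+1%:R != 0 :> R by rewrite nat1r pnatr_eq0.
rewrite !factS !natrM -(nat1r k.+1) !exprS.
move: (fac k) k1 k2; move: (k`!%:R) (k.+1%:R) (t ^+ k) => x y p *.
by field; do !(apply/andP; split).
Qed.

(** The sums converge to cosh y, and 2 cosh y = e^y + e^(-y). *)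
Lemma expR_le_cosh_bound (y M : R) :
  (forall n, \sum_(0 <= k < n) exp_coeff y k.*2 <= M) -> expR y <= 2 * M.
Proof.
move=> yM.
have even n : series (exp_coeff y) n.*2 + series (exp_coeff (- y)) n.*2 =
    2 * \sum_(0 <= k < n) exp_coeff y k.*2.
  elim: n => [|n IH]; first by rewrite /series/= !big_geq// mulr0 addr0.
  rewrite doubleS /series /= !big_nat_recr//= mulrDr -IH /series /= /exp_coeff /=.
  rewrite (exprNn y n.*2) (exprNn y n.*2.+1) -signr_odd -(signr_odd _ n.*2.+1).
  by rewrite /= odd_double /= expr0 expr1; ring.
have dbl : (fun n => n.*2) @ \oo --> \oo.
  by move=> A [N _ NA]; exists N => // n /= Nn; apply: NA => /=;
    rewrite -addnn; exact: leq_trans Nn (leq_addr _ _).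
have cvge (x : R) : series (exp_coeff x) n.*2 @[n --> \oo] --> expR x.
  by apply: (cvg_comp _ _ dbl); exact: is_cvg_series_exp_coeff.
have cvg2 : series (exp_coeff y) n.*2 + series (exp_coeff (- y)) n.*2
    @[n --> \oo] --> expR y + expR (- y).
  by apply: cvgD; exact: cvge.
have le2 : expR y + expR (- y) <= 2 * M.
  rewrite -(cvg_lim (@Rhausdorff R) cvg2).
  apply: limr_le; first by apply/cvg_ex; eexists; exact: cvg2.
  by apply: nearW => n; rewrite /= even ler_pM2l.
by apply: le_trans le2; rewrite lerDl expR_ge0.
Qed.
End cosh_series.

Section growth.
Local Open Scope ereal_scope.
Context {R : realType} {d : measure_display} {T : measurableType d}.
Variables (P : probability T R) (W : set (R * R) -> {RV P >-> R}).
Variables (kappa : R) (sg u0 v0 : R -> R) (u : R -> R -> T -> R).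
Hypotheses (hW : white_noise W) (kappa0 : (0 < kappa)%R).
Hypotheses (u0_ge0 : forall x, (0 <= u0 x)%R) (v0_ge0 : forall x, (0 <= v0 x)%R).
Hypothesis hu : mild_solution W kappa sg u0 v0 u.
Local Notation L := (L_lower sg).
Local Notation m0 := (inf (range u0)).
Hypotheses (m0_gt0 : (0 < m0)%R) (L_gt0 : (0 < L)%R).
Local Notation rate := (L * Num.sqrt (kappa / 2))%R.

(** Partial sums of the power series of m0^2 cosh(rate s). *)
Let partial (n : nat) (s : R) : R :=
  (m0 ^+ 2 * \sum_(0 <= k < n) exp_coeff (rate * s) k.*2)%R.

Let rate_sqr : (rate ^+ 2 = L ^+ 2 * (kappa / 2))%R.
Proof. by rewrite exprMn sqr_sqrtr// divr_ge0// ltW. Qed.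

Let partial_ge0 n s : (0 <= partial n s)%R.
Proof.
rewrite mulr_ge0 ?sqr_ge0// sumr_ge0// => k _.
by rewrite divr_ge0// exprn_even_ge0// odd_double.
Qed.

Let measurable_partial n : measurable_fun setT (partial n).
Proof.
apply: measurable_funM => //; apply: measurable_sum => k.
apply: measurable_funM => //; apply: measurable_funX.
exact: measurable_funM.
Qed.

Let partialS n t : (0 < t)%R ->
  (m0 ^+ 2)%:E + \int[lebesgue_measure]_(s in `]0%R, t])
    (L ^+ 2 * (kappa / 2) * ((t - s) * partial n s))%:E = (partial n.+1 t)%:E.
Proof.
move=> t0.
have [_ ] : has_integral (@lebesgue_measure R) `]0%R, t]%classic
    (fun s => \sum_(0 <= k < n) (m0 ^+ 2 * rate ^+ k.*2.+2) *
        ((t - s) * (s ^+ k.*2 / (k.*2)`!%:R)))%R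
    (\sum_(0 <= k < n) (m0 ^+ 2 * rate ^+ k.*2.+2) *
      (t ^+ k.*2.+2 / (k.*2.+2)`!%:R))%R.
  apply: has_integral_sum => [|k]; first exact: measurable_itv.
  apply: has_integralZ; first exact: measurable_itv.
  exact: has_integral_wave_monomial.
have -> : (\sum_(0 <= k < n) (m0 ^+ 2 * rate ^+ k.*2.+2) *
      (t ^+ k.*2.+2 / (k.*2.+2)`!%:R))%R = (partial n.+1 t - m0 ^+ 2)%R.
  rewrite /partial big_nat_recl//= mulrDr {1}/exp_coeff /= expr0 divr1 mulr1.
  rewrite addrAC subrr add0r mulr_sumr; apply: eq_bigr => k _.
  by rewrite doubleS /exp_coeff /= (exprMn _ rate t); ring.
move=> intE; rewrite [X in _ + X](_ : _ = (partial n.+1 t - m0 ^+ 2)%:E).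
  by rewrite -EFinD addrC subrK.
rewrite -intE; apply: eq_integral => s _; congr EFin.
rewrite /partial !mulr_sumr; apply: eq_bigr => k _.
rewrite -rate_sqr /exp_coeff /= (exprMn _ rate s); move: rate => r.
by rewrite !exprS; ring.
Qed.

Lemma second_moment_ge_partial n t x : (0 < t)%R ->
  (partial n t)%:E <= \int[P]_w (u t x w ^+ 2)%:E.
Proof.
elim: n t x => [|n IH] t x t0.
  rewrite /partial big_geq// mulr0.
  by apply: integral_ge0 => w _; rewrite lee_fin sqr_ge0.
rewrite -partialS//;
  apply: (second_moment_ge hW kappa0 u0_ge0 v0_ge0 hu m0_gt0 L_gt0) => //.
Qed.

Lemma second_moment_exponential t x : (0 < t)%R ->
  (m0 ^+ 2 / 2 * expR (rate * t))%:E <= 'E_P[fun w => (`|u t x w| ^+ 2)%R].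
Proof.
move=> t0; have [_ bounded _] := hu.
have -> : 'E_P[fun w => (`|u t x w| ^+ 2)%R] = \int[P]_w (u t x w ^+ 2)%:E.
  by rewrite unlock; apply: eq_integral => w _; rewrite real_normK// num_real.
have := fun n => second_moment_ge_partial n x t0.
case: (\int[P]_w (u t x w ^+ 2)%:E) => [M| |] partialM; last 2 first.
- exact: leey.
- by have := partialM 0%N; rewrite leNgt ltNyr.
have m2 : (0 < m0 ^+ 2)%R by rewrite exprn_gt0.
have key : (expR (rate * t) <= 2 * (M / m0 ^+ 2))%R.
  apply: expR_le_cosh_bound => n.
  by rewrite ler_pdivlMr// mulrC -lee_fin; exact: partialM.
rewrite lee_fin mulrAC ler_pdivrMr// -ler_pdivlMl//.
by rewrite [leRHS](_ : _ = 2 * (M / m0 ^+ 2))%R//; ring.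
Qed.

(** The constant in front of the exponential contributes ln C / t, which
    tends to 0. *)
Lemma upper_lyapunov2_ge : rate%:E <= upper_lyapunov2 P u.
Proof.
pose C := (m0 ^+ 2 / 2)%R.
have C0 : (0 < C)%R by rewrite divr_gt0// exprn_gt0.
apply: le_ereal_inf_tmp => _ [V [M [_ MV]] <-].
apply/lee_subgt0Pr => e e0.
(* beyond M, and so large that |ln C| / t <= e *)
pose b := Num.max M (Num.max 1 (`|ln C| / e))%R; pose t := (b + 1)%R.
have t0 : (0 < t)%R by rewrite /t ltr_wpDl// /b !le_max ler01 orbT.
have tM : (M < t)%R by rewrite /t (@le_lt_trans _ _ b)// ?ltrDl// /b le_max lexx.
have te : (`|ln C| <= e * t)%R.
  rewrite mulrC -ler_pdivrMr// /t (@le_trans _ _ b)// ?lerDl//.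
  by rewrite /b !le_max lexx !orbT.
set G := (X in X @` V).
apply: (@le_trans _ _ (G t)); last first.
  by apply: ereal_sup_ubound; exists t => //; exact: MV.
have lnE : (ln C + rate * t)%:E <=
    ereal_sup (range (fun x : R => lne 'E_P[fun w => (`|u t x w| ^+ 2)%R])).
  apply: le_ereal_sup_tmp; exists (lne 'E_P[fun w => (`|u t 0%R w| ^+ 2)%R]).
    by exists 0%R.
  rewrite -(expRK (rate * t)%R) -lnM ?posrE ?expR_gt0// -lne_EFin ?mulr_gt0 ?expR_gt0//.
  have E := second_moment_exponential 0 t0.
  rewrite lee_lne ?in_itv/= ?leey ?andbT//.
    by rewrite lee_fin mulr_ge0 ?expR_ge0// ltW.
  by apply: le_trans E; rewrite lee_fin mulr_ge0 ?expR_ge0// ltW.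
apply: (@le_trans _ _ ((t^-1)%:E * (ln C + rate * t)%:E)).
  rewrite -EFinB -EFinM lee_fin ler_pdivlMl//.
  by have := ler_norm (- ln C); rewrite normrN; nra.
by apply: lee_wpmul2l => //; rewrite lee_fin invr_ge0 ltW.
Qed.

End growth.

Theorem theorem2p3 (R : realType) (d : measure_display) (T : measurableType d)
    (P : probability T R) (W : set (R * R) -> {RV P >-> R})
    (kappa : R) (sg u0 v0 : R -> R) (u : R -> R -> T -> R) :
  white_noise W ->
  0 < kappa ->
  (exists K : R, K.-lipschitz sg) ->
  measurable_fun setT u0 ->
  (exists M : R, forall x, `|u0 x| <= M) ->
  (forall x, 0 <= u0 x) ->
  measurable_fun setT v0 ->
  (exists M : R, forall x, `|v0 x| <= M) ->
  mild_solution W kappa sg u0 v0 u ->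
  0 < inf (range u0) ->
  (forall x, 0 <= v0 x) ->
  0 < L_lower sg ->
  ((L_lower sg * Num.sqrt (kappa / 2))%:E <= upper_lyapunov2 P u)%E.
Proof.
move=> hW kappa0 _ _ _ u0_ge0 _ _ hu m0_gt0 v0_ge0 L_gt0.
exact: (upper_lyapunov2_ge hW kappa0 u0_ge0 v0_ge0 hu m0_gt0 L_gt0).
Qed.
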